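(* Let $p:E\to B$ be a locally sectionable continuous map of topological spaces, and let $S$ be a subset of $B$ such that the inverse image $E\times_BE\times_BE\times_BS$ of $S$ under the canonical map $E\times_BE\times_BE\to B$ meets every path-component of $E\times_BE\times_BE$. Let $\alpha,\beta:\pi_1(E\times_BE,S)\to\pi_1(E,S)$ be the functors induced respectively by the first and the second projections $p_1,p_2:E\times_BE\to E$, and let $\gamma:\pi_1(E,S)\to\pi_1(B,S)$ be the functor induced by $p$. Then $$\pi_1(E\times_BE,S)\ \underset{\beta}{\overset{\alpha}{\rightrightarrows}}\ \pi_1(E,S)\ \xrightarrow{\ \gamma\ }\ \pi_1(B,S)$$ is a coequalizer diagram in the category of groupoids.
   Context: A continuous map $p:E\to B$ of topological spaces is locally sectionable if for every $b\in B$ there exists an open subset $U$ of $B$ such that $b\in U$ and the map $p^{-1}(U)\to U$ induced by $p$ has a continuous section. For a space $X$ and a subset $A\subseteq X$, $\pi_1(X,A)$ denotes the fundamental groupoid of $X$ on the set $A$ of base points: objects are the points of $A$, morphisms are homotopy classes (relative to endpoints) of paths in $X$ with endpoints in $A$. Fibre products over $B$ are taken in the category of topological spaces. For $S\subseteq B$ one writes $\pi_1(E,S)$ for $\pi_1(E,p^{-1}(S))$ (with $p^{-1}(S)=E\times_BS$) and $\pi_1(E\times_BE,S)$ for $\pi_1(E\times_BE,E\times_BE\times_BS)$, where $E\times_BE\times_BS$ is the inverse image of $S$ under the canonical map $E\times_BE\to B$. *)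

(* Defs.v *)
From HB Require Import structures.
From mathcomp Require Import all_boot all_order all_algebra.
From mathcomp Require Import generic_quotient.
From mathcomp Require Import all_classical reals topology normedtype.
From mathcomp Require Import homotopy.
From mathcomp Require Import ring lra.

Set Implicit Arguments.
Unset Strict Implicit.
Unset Printing Implicit Defensive.

Import Order.TTheory GRing.Theory Num.Theory.
Import numFieldNormedType.Exports.

Local Open Scope classical_set_scope.
Local Open Scope ring_scope.
Local Open Scope quotient_scope.

(* Composition is written in diagrammatic order, matching concatenation of
   paths. *)
Record groupoid : Type := Groupoid {
  obj :> Type;
  hom : obj -> obj -> Type;
  idm : forall x, hom x x;
  cmp : forall x y z, hom x y -> hom y z -> hom x z;
  inv : forall x y, hom x y -> hom y x;
  cmp_assoc : forall x y z t (f : hom x y) (g : hom y z) (h : hom z t),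
    cmp (cmp f g) h = cmp f (cmp g h);
  cmp_idl : forall x y (f : hom x y), cmp (idm x) f = f;
  cmp_idr : forall x y (f : hom x y), cmp f (idm y) = f;
  cmp_invr : forall x y (f : hom x y), cmp f (inv f) = idm x;
  cmp_invl : forall x y (f : hom x y), cmp (inv f) f = idm y }.

Arguments hom {G} x y : rename.
Arguments idm {G} x : rename.
Arguments cmp {G x y z} f g : rename.
Arguments inv {G x y} f : rename.

Record functor (C D : groupoid) : Type := Functor {
  fobj :> C -> D;
  fhom : forall x y : C, hom x y -> hom (fobj x) (fobj y);
  fhom_idm : forall x, fhom (idm x) = idm (fobj x);
  fhom_cmp : forall x y z (f : hom x y) (g : hom y z),
    fhom (cmp f g) = cmp (fhom f) (fhom g) }.

Arguments fhom {C D} F {x y} f : rename.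

Section comp_functor.
Context (C D K : groupoid) (G : functor D K) (F : functor C D).

Let comp_fhom (x y : C) (f : hom x y) : hom (G (F x)) (G (F y)) :=
  fhom G (fhom F f).

Let comp_fhom_idm x : comp_fhom (idm x) = idm (G (F x)).
Proof. by rewrite /comp_fhom !fhom_idm. Qed.

Let comp_fhom_cmp x y z (f : hom x y) (g : hom y z) :
  comp_fhom (cmp f g) = cmp (comp_fhom f) (comp_fhom g).
Proof. by rewrite /comp_fhom !fhom_cmp. Qed.

Definition comp_functor : functor C K :=
  @Functor C K (G \o F) comp_fhom comp_fhom_idm comp_fhom_cmp.

End comp_functor.

(* Equalities of functors are strict (equality on objects and morphisms), as
   usual in the 1-category of groupoids. *)
Definition is_coequalizer (C D K : groupoid)
    (a b : functor C D) (c : functor D K) : Prop :=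
  comp_functor c a = comp_functor c b /\
  forall (L : groupoid) (F : functor D L),
    comp_functor F a = comp_functor F b ->
    exists! G : functor K L, comp_functor G c = F.

(* The map p^-1(U) -> U induced by p. *)
Definition preimage_map (E B : Type) (p : E -> B) (U : set B)
    (x : p @^-1` U) : U :=
  exist _ (p (sval x)) (mem_set (set_mem (svalP x) : U (p (sval x)))).

Definition locally_sectionable (E B : topologicalType) (p : E -> B) : Prop :=
  forall b : B, exists U : set B, [/\ open U, U b &
    exists s : U -> p @^-1` U, continuous s /\ cancel s (@preimage_map _ _ p U)].

Definition fibre_product (X Y B : Type) (f : X -> B) (g : Y -> B) : Type :=
  [set z : X * Y | f z.1 = g z.2].

HB.instance Definition _ (X Y B : topologicalType) (f : X -> B) (g : Y -> B) :=
  Topological.copy (fibre_product f g) [set z : X * Y | f z.1 = g z.2].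

Definition fst_proj X Y B (f : X -> B) (g : Y -> B) (z : fibre_product f g) : X :=
  (sval z).1.
Definition snd_proj X Y B (f : X -> B) (g : Y -> B) (z : fibre_product f g) : Y :=
  (sval z).2.
(* The canonical map to the base; it also equals g \o snd_proj f g (fp_baseE). *)
Definition fp_base X Y B (f : X -> B) (g : Y -> B) : fibre_product f g -> B :=
  f \o @fst_proj X Y B f g.

Arguments fst_proj {X Y B} f g z.
Arguments snd_proj {X Y B} f g z.
Arguments fp_base {X Y B} f g z.

Lemma fp_baseE X Y B (f : X -> B) (g : Y -> B) z :
  fp_base f g z = g (snd_proj f g z).
Proof. exact: (set_mem (svalP z)). Qed.

Lemma fst_proj_over X Y B (f : X -> B) (g : Y -> B) (S : set B) z :
  (fp_base f g @^-1` S) z -> (f @^-1` S) (fst_proj f g z).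
Proof. by []. Qed.

Lemma snd_proj_over X Y B (f : X -> B) (g : Y -> B) (S : set B) z :
  (fp_base f g @^-1` S) z -> (g @^-1` S) (snd_proj f g z).
Proof. by rewrite /preimage /= fp_baseE. Qed.

Lemma map_over X B (f : X -> B) (S : set B) x : (f @^-1` S) x -> S (f x).
Proof. by []. Qed.

Section fibre_product_continuity.
Context (X Y B : topologicalType).

Lemma fst_proj_continuous (f : X -> B) (g : Y -> B) :
  continuous (fst_proj f g).
Proof.
move=> z; apply: (@continuous_comp _ _ _ (set_val : [set z | f z.1 = g z.2] -> _)
  fst); [exact: initial_continuous | exact: cvg_fst].
Qed.

Lemma snd_proj_continuous (f : X -> B) (g : Y -> B) :
  continuous (snd_proj f g).
Proof.
move=> z; apply: (@continuous_comp _ _ _ (set_val : [set z | f z.1 = g z.2] -> _)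
  snd); [exact: initial_continuous | exact: cvg_snd].
Qed.

HB.instance Definition _ (f : X -> B) (g : Y -> B) :=
  @isContinuous.Build _ _ (fst_proj f g) (@fst_proj_continuous f g).
HB.instance Definition _ (f : X -> B) (g : Y -> B) :=
  @isContinuous.Build _ _ (snd_proj f g) (@snd_proj_continuous f g).

End fibre_product_continuity.

Definition unit_interval (R : realType) : Type := `[0 : R, 1]%classic.

Section unit_interval.
Context {R : realType}.
Local Notation I := (unit_interval R).

HB.instance Definition _ := Topological.copy I `[0 : R, 1]%classic.

Lemma clamp_subproof (x : R) :
  Num.max 0 (Num.min 1 x) \in `[0 : R, 1]%classic.
Proof.
by apply/mem_set; rewrite /= in_itv /= le_max lexx ge_max ler01 ge_min lexx.
Qed.

(* The retraction of R onto [0, 1]. *)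
Definition clamp (x : R) : I := exist _ (Num.max 0 (Num.min 1 x)) (clamp_subproof x).

Lemma unit_interval_itv (t : I) : 0 <= sval t <= 1.
Proof. by case: t => t /= /set_mem; rewrite /= in_itv. Qed.

Lemma clampK (x : R) : 0 <= x <= 1 -> sval (clamp x) = x.
Proof. by case/andP=> x0 x1 /=; rewrite min_r // max_r. Qed.

Lemma clamp_le0 (x : R) : x <= 0 -> clamp x = clamp 0.
Proof.
move=> x0; apply: val_inj => /=.
rewrite (min_r (le_trans x0 ler01)) (max_l x0).
by rewrite (min_r (@ler01 R)) maxxx.
Qed.

Lemma clamp_ge1 (x : R) : 1 <= x -> clamp x = clamp 1.
Proof. by move=> x1; apply: val_inj => /=; rewrite min_l // minxx. Qed.

Arguments clamp x : simpl never.

Lemma svalK (t : I) : clamp (sval t) = t.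
Proof. by apply: val_inj; exact/clampK/unit_interval_itv. Qed.

Let clamp_neq : clamp 0 != clamp 1.
Proof.
apply/eqP => /(congr1 sval); rewrite !clampK ?lexx ?ler01 //.
by move/eqP; rewrite eq_sym oner_eq0.
Qed.

HB.instance Definition _ := isBiPointed.Build I clamp_neq.

Lemma sval_zero : sval (zero : I) = 0.
Proof. by apply: clampK; rewrite lexx ler01. Qed.

Lemma sval_one : sval (one : I) = 1.
Proof. by apply: clampK; rewrite lexx ler01. Qed.

Lemma sval_continuous : continuous (sval : I -> R).
Proof. exact: (@initial_continuous (`[0 : R, 1]%classic : Type) R set_val). Qed.


Lemma to_set_type_continuous (Z X : topologicalType) (A : set X) (f : Z -> A) :
  continuous (fun z => sval (f z)) -> continuous f.
Proof.
move=> cf; apply/continuousP => _ [U oU <-].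
by have /continuousP := cf; apply.
Qed.

Lemma clamp_continuous : continuous clamp.
Proof.
apply: (@to_set_type_continuous _ _ `[0 : R, 1]%classic).
apply: max_fun_continuous; first by move=> x; exact: cvg_cst.
by apply: min_fun_continuous => x; [exact: cvg_cst|exact: cvg_id].
Qed.

End unit_interval.

Lemma comp_continuous (X Y Z : topologicalType) (g : Y -> Z) (f : X -> Y) :
  continuous g -> continuous f -> continuous (fun x => g (f x)).
Proof. by move=> cg cf x; apply: (@continuous_comp _ _ _ f g); [exact: cf|exact: cg]. Qed.

Lemma pair_continuous (X Y Z : topologicalType) (f : X -> Y) (g : X -> Z) :
  continuous f -> continuous g -> continuous (fun x => (f x, g x)).
Proof. by move=> cf cg x; apply: cvg_pair; [exact: cf|exact: cg]. Qed.

Section glue.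
Context {R : realType} (Z X : topologicalType).

Lemma glue_continuous (g : Z -> R) (f1 f2 : Z -> X) :
  continuous g -> continuous f1 -> continuous f2 ->
  (forall z, g z = 2^-1 -> f1 z = f2 z) ->
  continuous (fun z => if g z <= 2^-1 then f1 z else f2 z).
Proof.
move=> cg cf1 cf2 f12; set h := (fun z => _).
have E1 : {in [set z | g z <= 2^-1], f1 =1 h}.
  by move=> z /set_mem /= gz; rewrite /h gz.
have E2 : {in [set z | 2^-1 <= g z], f2 =1 h}.
  move=> z /set_mem /= gz; rewrite /h; case: ifPn => // gz'.
  by rewrite f12 //; apply/eqP; rewrite eq_le gz gz'.
have c1 : closed [set z | g z <= 2^-1].
  by apply: (@preimage_closed _ _ g [set x | x <= 2^-1]) => //; exact: closed_le.
have c2 : closed [set z | 2^-1 <= g z].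
  by apply: (@preimage_closed _ _ g [set x | 2^-1 <= x]) => //; exact: closed_ge.
apply/continuous_subspace_setT.
rewrite (_ : setT = [set z | g z <= 2^-1] `|` [set z | 2^-1 <= g z]); last first.
  by apply/seteqP; split=> z //= _; have [?|/ltW ?] := leP (g z) 2^-1; [left|right].
apply: withinU_continuous => //.
  by apply: (subspace_eq_continuous E1); exact: continuous_subspaceT.
by apply: (subspace_eq_continuous E2); exact: continuous_subspaceT.
Qed.

End glue.

Section paths.
Context {R : realType} {X : topologicalType}.
Local Notation I := (unit_interval R).
Implicit Types x y : X.

Lemma clamp_fun_continuous (Z : topologicalType) (h : Z -> R) :
  continuous h -> continuous (fun t => clamp (h t)).
Proof. exact/comp_continuous/clamp_continuous. Qed.

Lemma sval_fun_continuous (Z : topologicalType) (h : Z -> I) :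
  continuous h -> continuous (fun t => sval (h t)).
Proof. exact/comp_continuous/sval_continuous. Qed.

Lemma scaled_continuous (Z : topologicalType) (h : Z -> R) (a b : R) :
  continuous h -> continuous (fun t => a * h t + b).
Proof.
by move=> ch t; apply: cvgD; [apply: cvgM; [exact: cvg_cst|exact: ch]|exact: cvg_cst].
Qed.

Definition affine (a b : R) (t : I) : I := clamp (a * sval t + b).

Lemma affine_continuous a b : continuous (affine a b).
Proof.
by apply: clamp_fun_continuous; apply: scaled_continuous; exact: sval_continuous.
Qed.

Definition cat_fun (f g : I -> X) (t : I) : X :=
  if sval t <= 2^-1 then f (affine 2 0 t) else g (affine 2 (- 1) t).

Section concatenation.
Context x y z (p : {path I from x to y}) (q : {path I from y to z}).

Let affine_half0 (t : I) : sval t = 2^-1 -> affine 2 0 t = one.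
Proof. by move=> th; rewrite /affine th; congr clamp; lra. Qed.

Let affine_half1 (t : I) : sval t = 2^-1 -> affine 2 (- 1) t = zero.
Proof. by move=> th; rewrite /affine th; congr clamp; lra. Qed.

Let cat_continuous : continuous (cat_fun p q).
Proof.
apply: glue_continuous; first exact: sval_continuous.
- by apply: comp_continuous; [exact: (@cts_fun _ _ p)|exact: affine_continuous].
- by apply: comp_continuous; [exact: (@cts_fun _ _ q)|exact: affine_continuous].
by move=> t th; rewrite affine_half0 // affine_half1 // path_one path_zero.
Qed.

Let cat_zero : cat_fun p q zero = x.
Proof.
rewrite /cat_fun sval_zero ifT; last by lra.
by rewrite -[RHS](path_zero (s := p)) /affine sval_zero; congr (p (clamp _)); lra.
Qed.

Let cat_one : cat_fun p q one = z.
Proof.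
rewrite /cat_fun sval_one ifF; last by apply/negbTE; lra.
by rewrite -[RHS](path_one (s := q)) /affine sval_one; congr (q (clamp _)); lra.
Qed.

Definition cat_path : {path I from x to z} :=
  mk_path cat_continuous cat_zero cat_one.

End concatenation.

Section reversal.
Context x y (p : {path I from x to y}).

Let rev_continuous : continuous (fun t => p (affine (- 1) 1 t)).
Proof. by apply: comp_continuous; [exact: (@cts_fun _ _ p)|exact: affine_continuous]. Qed.

Let rev_zero : p (affine (- 1) 1 zero) = y.
Proof.
by rewrite -[RHS](path_one (s := p)) /affine sval_zero; congr (p (clamp _)); lra.
Qed.

Let rev_one : p (affine (- 1) 1 one) = x.
Proof.
by rewrite -[RHS](path_zero (s := p)) /affine sval_one; congr (p (clamp _)); lra.
Qed.

Definition rev_path : {path I from y to x} :=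
  mk_path rev_continuous rev_zero rev_one.

End reversal.

Definition path_homotopic x y (p q : {path I from x to y}) : Prop :=
  exists H : I * I -> X, [/\ continuous H,
    forall t, H (zero, t) = p t, forall t, H (one, t) = q t,
    forall s, H (s, zero) = x & forall s, H (s, one) = y].

Lemma reparam_homotopic x y (p q : {path I from x to y})
    (f : I -> X) (u v : I -> I) :
  continuous f -> continuous u -> continuous v ->
  u zero = v zero -> u one = v one ->
  (forall t, p t = f (u t)) -> (forall t, q t = f (v t)) ->
  path_homotopic p q.
Proof.
move=> cf cu cv uv0 uv1 pE qE.
pose h (z : I * I) : R :=
  (1 - sval z.1) * sval (u z.2) + sval z.1 * sval (v z.2).
have ch : continuous h.
  have c1 : continuous (fun z : I * I => sval z.1 : R).
    by apply: sval_fun_continuous => z; exact: cvg_fst.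
  have c2 (w : I -> I) : continuous w -> continuous (fun z : I * I => sval (w z.2) : R).
    move=> cw; apply: sval_fun_continuous; apply: (comp_continuous cw) => z.
    exact: cvg_snd.
  move=> z; apply: cvgD; apply: cvgM; [|exact: c2|exact: c1|exact: c2].
  by apply: cvgB; [exact: cvg_cst|exact: c1].
exists (fun z => f (clamp (h z))); split.
- exact: (comp_continuous cf (clamp_fun_continuous ch)).
- by move=> t; rewrite pE -[in RHS](svalK (u t)) /h sval_zero; congr (f (clamp _)); ring.
- by move=> t; rewrite qE -[in RHS](svalK (v t)) /h sval_one; congr (f (clamp _)); ring.
- move=> s; rewrite -(path_zero (s := p)) pE -[in RHS](svalK (u _)) /h -uv0.
  by congr (f (clamp _)); ring.
- move=> s; rewrite -(path_one (s := p)) pE -[in RHS](svalK (u _)) /h -uv1.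
  by congr (f (clamp _)); ring.
Qed.

Lemma path_homotopic_refl x y (p : {path I from x to y}) : path_homotopic p p.
Proof.
by apply: (@reparam_homotopic _ _ p p p id id) => //; [exact: cts_fun| |]; move=> t; exact: cvg_id.
Qed.

Lemma path_homotopic_sym x y (p q : {path I from x to y}) :
  path_homotopic p q -> path_homotopic q p.
Proof.
move=> [H [cH H0 H1 Hx Hy]].
exists (fun z => H (affine (- 1) 1 z.1, z.2)); split => //.
- apply: (comp_continuous cH); apply: pair_continuous.
    by apply: (comp_continuous (@affine_continuous _ _)) => z; exact: cvg_fst.
  by move=> z; exact: cvg_snd.
- move=> t; simpl fst; simpl snd; rewrite /affine sval_zero -H1; congr (H (clamp _, _)); lra.
- move=> t; simpl fst; simpl snd; rewrite /affine sval_one -H0; congr (H (clamp _, _)); lra.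
Qed.

Lemma path_homotopic_trans x y (p q r : {path I from x to y}) :
  path_homotopic p q -> path_homotopic q r -> path_homotopic p r.
Proof.
move=> [H [cH H0 H1 Hx Hy]] [K [cK K0 K1 Kx Ky]].
exists (fun z => if sval z.1 <= 2^-1 then H (affine 2 0 z.1, z.2)
                 else K (affine 2 (- 1) z.1, z.2)).
have c1 a b : continuous (fun z : I * I => (affine a b z.1, z.2)).
  apply: pair_continuous; last by move=> z; exact: cvg_snd.
  by apply: (comp_continuous (@affine_continuous _ _)) => z; exact: cvg_fst.
split.
- apply: glue_continuous.
  + by apply: sval_fun_continuous => z; exact: cvg_fst.
  + by apply: comp_continuous; [exact: cH|exact: c1].
  + by apply: comp_continuous; [exact: cK|exact: c1].
  + move=> [s t] /= sh.
    have -> : affine 2 0 s = one by rewrite /affine sh; congr clamp; lra.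
    have -> : affine 2 (-1) s = zero by rewrite /affine sh; congr clamp; lra.
    by rewrite H1 K0.
- move=> t; simpl fst; simpl snd; rewrite sval_zero ifT; last by lra.
  by rewrite -H0 /affine sval_zero; congr (H (clamp _, _)); lra.
- move=> t; simpl fst; simpl snd; rewrite sval_one ifF; last by apply/negbTE; lra.
  by rewrite -K1 /affine sval_one; congr (K (clamp _, _)); lra.
- by move=> s /=; case: ifP.
- by move=> s /=; case: ifP.
Qed.

Lemma cat_path_homotopic x y z (p p' : {path I from x to y})
    (q q' : {path I from y to z}) :
  path_homotopic p p' -> path_homotopic q q' ->
  path_homotopic (cat_path p q) (cat_path p' q').
Proof.
move=> [H [cH H0 H1 Hx Hy]] [K [cK K0 K1 Kx Ky]].
exists (fun w => if sval w.2 <= 2^-1 then H (w.1, affine 2 0 w.2)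
                 else K (w.1, affine 2 (- 1) w.2)).
have c1 a b : continuous (fun w : I * I => (w.1, affine a b w.2)).
  apply: pair_continuous; first by move=> w; exact: cvg_fst.
  by apply: (comp_continuous (@affine_continuous _ _)) => w; exact: cvg_snd.
split.
- apply: glue_continuous.
  + by apply: sval_fun_continuous => w; exact: cvg_snd.
  + by apply: comp_continuous; [exact: cH|exact: c1].
  + by apply: comp_continuous; [exact: cK|exact: c1].
  + move=> [s t] /= sh.
    have -> : affine 2 0 t = one by rewrite /affine sh; congr clamp; lra.
    have -> : affine 2 (-1) t = zero by rewrite /affine sh; congr clamp; lra.
    by rewrite Hy Kx.
- by move=> t; rewrite /= /mk_path /cat_fun H0 K0.
- by move=> t; rewrite /= /mk_path /cat_fun H1 K1.
- move=> s; simpl fst; simpl snd; rewrite sval_zero ifT; last by lra.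
  by rewrite -(Hx s) /affine sval_zero; congr (H (_, clamp _)); lra.
- move=> s; simpl fst; simpl snd; rewrite sval_one ifF; last by apply/negbTE; lra.
  by rewrite -(Ky s) /affine sval_one; congr (K (_, clamp _)); lra.
Qed.

Lemma rev_path_homotopic x y (p q : {path I from x to y}) :
  path_homotopic p q -> path_homotopic (rev_path p) (rev_path q).
Proof.
move=> [H [cH H0 H1 Hx Hy]].
exists (fun w => H (w.1, affine (- 1) 1 w.2)); split.
- apply: (comp_continuous cH); apply: pair_continuous.
    by move=> w; exact: cvg_fst.
  by apply: (comp_continuous (@affine_continuous _ _)) => w; exact: cvg_snd.
- by move=> t; rewrite /= H0.
- by move=> t; rewrite /= H1.
- by move=> s; rewrite /= -(Hy s) /affine sval_zero; congr (H (_, clamp _)); lra.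
- by move=> s; rewrite /= -(Hx s) /affine sval_one; congr (H (_, clamp _)); lra.
Qed.

Lemma cat_path_assoc x y z w (p : {path I from x to y})
    (q : {path I from y to z}) (r : {path I from z to w}) :
  path_homotopic (cat_path (cat_path p q) r) (cat_path p (cat_path q r)).
Proof.
pose u (t : I) : I :=
  clamp (Num.min (2 * sval t + 0) (Num.min (1 * sval t + 4^-1) (2^-1 * sval t + 2^-1))).
apply: (@reparam_homotopic _ _ _ _ (cat_path p (cat_path q r)) u id) => //.
- exact: cts_fun.
- apply: clamp_fun_continuous; apply: min_fun_continuous.
    apply: scaled_continuous; exact: sval_continuous.
  by apply: min_fun_continuous; apply: scaled_continuous; exact: sval_continuous.
- by move=> t; exact: cvg_id.
- rewrite /u sval_zero; congr clamp.
  rewrite min_l; first lra.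
  by rewrite le_min; apply/andP; split; lra.
- rewrite /u sval_one; rewrite -[RHS]svalK sval_one; congr clamp.
  rewrite min_r ?min_r; try lra.
move=> t; have /andP[t0 t1] := unit_interval_itv t.
rewrite /= /mk_path /cat_fun /mk_path /cat_fun /affine /u.
move: (sval t) t0 t1 => {}t t0 t1.
have [t2|t2] := leP t 2^-1.
  have [t4|t4] := leP t 4^-1.
    have -> : Num.min (2 * t + 0) (Num.min (1 * t + 4^-1) (2^-1 * t + 2^-1)) = 2 * t.
      rewrite min_l; first lra.
      by rewrite le_min; apply/andP; split; lra.
    rewrite clampK; last by lra.
    rewrite ifT; last by lra.
    rewrite clampK; last by lra.
    by rewrite ifT; [congr (p (clamp _)); lra|lra].
  have -> : Num.min (2 * t + 0) (Num.min (1 * t + 4^-1) (2^-1 * t + 2^-1)) = t + 4^-1.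
    by rewrite min_r ?min_l; lra.
  rewrite clampK; last by lra.
  rewrite ifF; last by apply/negbTE; lra.
  rewrite clampK; last by lra.
  rewrite ifF; last by apply/negbTE; lra.
  rewrite clampK; last by lra.
  by rewrite ifT; [congr (q (clamp _)); lra|lra].
have -> : Num.min (2 * t + 0) (Num.min (1 * t + 4^-1) (2^-1 * t + 2^-1)) = 2^-1 * t + 2^-1.
  by rewrite min_r ?min_r; lra.
rewrite clampK; last by lra.
rewrite ifF; last by apply/negbTE; lra.
rewrite clampK; last by lra.
rewrite ifF; last by apply/negbTE; lra.
by congr (r (clamp _)); lra.
Qed.

Lemma cat_path_cstl x y (p : {path I from x to y}) :
  path_homotopic (cat_path (cst x : {path I from x to x}) p) p.
Proof.
apply: (@reparam_homotopic _ _ _ _ p (affine 2 (- 1)) id) => //.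
- exact: cts_fun.
- exact: affine_continuous.
- by move=> t; exact: cvg_id.
- by rewrite /affine sval_zero clamp_le0 //; lra.
- by rewrite /affine sval_one; congr clamp; lra.
move=> t; rewrite /= /mk_path /cat_fun; case: ifPn => // th.
by rewrite /affine (@clamp_le0 _ (2 * sval t - 1)); [exact/esym/(path_zero (s := p))|lra].
Qed.

Lemma cat_path_cstr x y (p : {path I from x to y}) :
  path_homotopic (cat_path p (cst y : {path I from y to y})) p.
Proof.
apply: (@reparam_homotopic _ _ _ _ p (affine 2 0) id) => //.
- exact: cts_fun.
- exact: affine_continuous.
- by move=> t; exact: cvg_id.
- by rewrite /affine sval_zero; congr clamp; lra.
- by rewrite /affine sval_one clamp_ge1 //; lra.
move=> t; rewrite /= /mk_path /cat_fun; case: ifPn => // th.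
have {th}th : 2^-1 < sval t by rewrite ltNge.
by rewrite /affine (@clamp_ge1 _ (2 * sval t + 0)); [exact/esym/(path_one (s := p))|lra].
Qed.

Lemma cat_path_revr x y (p : {path I from x to y}) :
  path_homotopic (cat_path p (rev_path p)) (cst x : {path I from x to x}).
Proof.
pose u (t : I) : I := clamp (Num.min (2 * sval t + 0) (- 2 * sval t + 2)).
apply: (@reparam_homotopic _ _ _ _ p u (cst zero)) => //.
- exact: cts_fun.
- by apply: clamp_fun_continuous; apply: min_fun_continuous;
    apply: scaled_continuous; exact: sval_continuous.
- exact: cst_continuous.
- by rewrite /u sval_zero; congr clamp; rewrite min_l; lra.
- by rewrite /u sval_one; congr clamp; rewrite min_r; lra.
- move=> t; have /andP[t0 t1] := unit_interval_itv t.
  rewrite /= /mk_path /cat_fun /mk_path /affine /u.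
  case: ifPn => th; first by congr (p (clamp _)); rewrite min_l; lra.
  rewrite min_r; last lra.
  by rewrite clampK; [congr (p (clamp _)); lra|lra].
- by move=> t /=; rewrite (path_zero (s := p)).
Qed.

Lemma rev_pathK x y (p : {path I from x to y}) : rev_path (rev_path p) = p.
Proof.
apply/path_eqP => t; have t01 := unit_interval_itv t.
rewrite /= /mk_path /affine clampK; last lra.
by rewrite -[in RHS](svalK t); congr (p (clamp _)); lra.
Qed.

Lemma cat_path_revl x y (p : {path I from x to y}) :
  path_homotopic (cat_path (rev_path p) p) (cst y : {path I from y to y}).
Proof. by rewrite -{2}(rev_pathK p); exact: cat_path_revr. Qed.

Definition path_homotopicb x y : rel {path I from x to y} :=
  fun p q => `[< path_homotopic p q >].

Let path_homotopicb_refl x y : reflexive (@path_homotopicb x y).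
Proof. by move=> p; apply/asboolP; exact: path_homotopic_refl. Qed.

Let path_homotopicb_sym x y : symmetric (@path_homotopicb x y).
Proof.
by move=> p q; apply/asboolP/asboolP; exact: path_homotopic_sym.
Qed.

Let path_homotopicb_trans x y : transitive (@path_homotopicb x y).
Proof.
move=> q p r /asboolP pq /asboolP qr; apply/asboolP.
exact: path_homotopic_trans pq qr.
Qed.

Canonical path_homotopicb_equiv x y :=
  EquivRel (@path_homotopicb x y) (@path_homotopicb_refl x y)
    (@path_homotopicb_sym x y) (@path_homotopicb_trans x y).

Definition path_class x y := {eq_quot @path_homotopicb_equiv x y}.

Definition class_of x y (p : {path I from x to y}) : path_class x y :=
  \pi_(path_class x y) p.

Lemma class_ofK x y (a : path_class x y) : class_of (repr a) = a.
Proof. exact: reprK. Qed.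

Lemma path_classP x y (p q : {path I from x to y}) :
  class_of p = class_of q <-> path_homotopic p q.
Proof. by split=> [/eqmodP/asboolP|pq] //; apply/eqmodP/asboolP. Qed.

Lemma path_class_reprK x y (p : {path I from x to y}) :
  path_homotopic (repr (class_of p)) p.
Proof. by apply/path_classP; exact: class_ofK. Qed.

Definition class_cst x : path_class x x :=
  class_of (cst x : {path I from x to x}).

Definition class_cat x y z (a : path_class x y) (b : path_class y z) :
  path_class x z := class_of (cat_path (repr a) (repr b)).

Definition class_rev x y (a : path_class x y) : path_class y x :=
  class_of (rev_path (repr a)).

Lemma class_catE x y z (p : {path I from x to y}) (q : {path I from y to z}) :
  class_cat (class_of p) (class_of q) = class_of (cat_path p q).
Proof. by apply/path_classP/cat_path_homotopic; exact: path_class_reprK. Qed.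

Lemma class_revE x y (p : {path I from x to y}) :
  class_rev (class_of p) = class_of (rev_path p).
Proof. by apply/path_classP/rev_path_homotopic/path_class_reprK. Qed.

Lemma class_cat_assoc x y z w (a : path_class x y) (b : path_class y z)
    (c : path_class z w) :
  class_cat (class_cat a b) c = class_cat a (class_cat b c).
Proof.
rewrite -[a]class_ofK -[b]class_ofK -[c]class_ofK !class_catE.
exact/path_classP/cat_path_assoc.
Qed.

Lemma class_cat_cstl x y (a : path_class x y) : class_cat (class_cst x) a = a.
Proof. by rewrite -[a]class_ofK class_catE; apply/path_classP/cat_path_cstl. Qed.

Lemma class_cat_cstr x y (a : path_class x y) : class_cat a (class_cst y) = a.
Proof. by rewrite -[a]class_ofK class_catE; apply/path_classP/cat_path_cstr. Qed.

Lemma class_cat_revr x y (a : path_class x y) :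
  class_cat a (class_rev a) = class_cst x.
Proof.
by rewrite -[a]class_ofK class_revE class_catE; apply/path_classP/cat_path_revr.
Qed.

Lemma class_cat_revl x y (a : path_class x y) :
  class_cat (class_rev a) a = class_cst y.
Proof.
by rewrite -[a]class_ofK class_revE class_catE; apply/path_classP/cat_path_revl.
Qed.

Definition path_component x : set X :=
  [set y | inhabited {path I from x to y}].

Definition meets_path_components (A : set X) : Prop :=
  forall x, path_component x `&` A !=set0.

End paths.

Arguments path_class R {X} x y.
Arguments path_component R {X} x.
Arguments meets_path_components R {X} A.

(* The fundamental groupoid of X on the set A of base points. *)
Definition pi1 (R : realType) (X : topologicalType) (A : set X) : groupoid :=
  {| obj := A;
     hom := fun a b => path_class R (sval a) (sval b);
     idm := fun a => class_cst (sval a);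
     cmp := fun _ _ _ f g => class_cat f g;
     inv := fun _ _ f => class_rev f;
     cmp_assoc := fun _ _ _ _ f g h => class_cat_assoc f g h;
     cmp_idl := fun _ _ f => class_cat_cstl f;
     cmp_idr := fun _ _ f => class_cat_cstr f;
     cmp_invr := fun _ _ f => class_cat_revr f;
     cmp_invl := fun _ _ f => class_cat_revl f |}.

Arguments pi1 R {X} A.

Section induced_functor.
Context (R : realType) (X Y : topologicalType) (f : continuousType X Y).
Local Notation I := (unit_interval R).

Definition class_map (x y : X) (a : path_class R x y) :
    path_class R (f x) (f y) :=
  class_of (f \o repr a : {path I from f x to f y}).

Lemma comp_path_homotopic (x y : X) (p q : {path I from x to y}) :
  path_homotopic p q ->
  path_homotopic (f \o p : {path I from f x to f y}) (f \o q).
Proof.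
move=> [H [cH H0 H1 Hx Hy]]; exists (f \o H); split => /=.
- exact: (comp_continuous (@cts_fun _ _ f) cH).
- by move=> t; rewrite H0.
- by move=> t; rewrite H1.
- by move=> s; rewrite Hx.
- by move=> s; rewrite Hy.
Qed.

Lemma class_mapE (x y : X) (p : {path I from x to y}) :
  class_map (class_of p) = class_of (f \o p : {path I from f x to f y}).
Proof. by apply/path_classP/comp_path_homotopic/path_class_reprK. Qed.

Lemma class_map_cst (x : X) :
  class_map (class_cst x) = class_cst (f x).
Proof. by rewrite class_mapE; congr (class_of _); apply/path_eqP. Qed.

Lemma class_map_cat (x y z : X) (a : path_class R x y) (b : path_class R y z) :
  class_map (class_cat a b) = class_cat (class_map a) (class_map b).
Proof.
rewrite -[a]class_ofK -[b]class_ofK class_catE !class_mapE class_catE.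
congr (class_of _); apply/path_eqP => t /=.
by rewrite /mk_path /cat_fun; case: ifP.
Qed.

Context (A : set X) (C : set Y) (fAC : forall x, A x -> C (f x)).

Let map_obj (a : A) : C := exist _ (f (sval a)) (mem_set (fAC (set_mem (svalP a)))).

Definition pi1_map : functor (pi1 R A) (pi1 R C) :=
  @Functor (pi1 R A) (pi1 R C) map_obj
    (fun a b => @class_map (sval a) (sval b))
    (fun a => class_map_cst (sval a))
    (fun a b c => @class_map_cat (sval a) (sval b) (sval c)).

End induced_functor.

Arguments pi1_map R {X Y} f {A C} fAC.

(* Main.v *)
Require Import Defs.
From mathcomp Require Import all_boot all_order all_algebra.
From mathcomp Require Import all_classical reals topology normedtype homotopy.
From mathcomp Require Import ring lra.
Import Defs.

Set Implicit Arguments.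
Unset Strict Implicit.
Unset Printing Implicit Defensive.

Import Order.TTheory GRing.Theory Num.Theory.
Import numFieldNormedType.Exports.

Local Open Scope classical_set_scope.
Local Open Scope ring_scope.

(** The diagram commutes because both composites send a path of E x_B E to its
    image in B.  For the universal property, let F be a functor on the
    groupoid of E that identifies the two projections.

    A path of B is locally the image of a path of E, through the local
    sections.  Cutting it finely and lifting each piece suggests the value of
    the factorization: the product of the values of F on the pieces.  Two
    obstacles stand in the way.  The cutting points need not lie over S, and
    consecutive lifts do not match at the cutting points.

    Both are removed by the condition on path components.  Three points of E
    over the same point of B can be moved simultaneously, by paths with the
    same image in B, to points over S ([triple_paths]).  Moving a point of E
    together with a reference point of its fibre gives an arrow from F at the
    end of the move to an object of L attached to that fibre (a [leg]); the
    hypothesis on F makes it independent of the move ([proper_leg_unique]).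
    Conjugating by legs, F acquires a value on every path of E, whatever its
    end points ([lift_value]).  This value is multiplicative, and it depends
    on the image in B alone: the third point of the triple compares the legs
    of two lifts with one and the same reference point
    ([lift_value_fibre]).

    What remains is a local-to-global argument.  A multiplicative value on
    paths of E that depends on the image in B alone extends uniquely to curves
    of B, since any two cuttings can be refined ([transport_exists],
    [transport_unique]).  It is homotopy invariant because a homotopy, cut into
    small squares that lift to E, commutes on each small square and hence on
    the large one ([square_commutesP]).  This defines the factorization
    ([glued_functor]).

    It is unique because the groupoid of B is generated by images of paths of
    E between points over S ([generated_by_lifts]): cut a path, lift the
    pieces, and insert at each cutting point a detour to S and back. *)

(** * Groupoids and strict equality of functors *)

Section groupoid_theory.
Context {G : groupoid}.
Implicit Types x y z t : G.

Lemma cmpKl x y z (f : hom x y) (g : hom y z) : cmp (inv f) (cmp f g) = g.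
Proof. by rewrite -cmp_assoc cmp_invl cmp_idl. Qed.

Lemma cmpVKl x y z (f : hom x y) (g : hom x z) : cmp f (cmp (inv f) g) = g.
Proof. by rewrite -cmp_assoc cmp_invr cmp_idl. Qed.

Lemma cmp_cancel_l x y z (f : hom x y) (g h : hom y z) :
  cmp f g = cmp f h -> g = h.
Proof. by move=> /(congr1 (cmp (inv f))); rewrite !cmpKl. Qed.

Lemma idempotent_idm x (f : hom x x) : cmp f f = f -> f = idm x.
Proof. by move=> ff; apply: (@cmp_cancel_l _ _ _ f); rewrite cmp_idr. Qed.

Lemma inv_uniq x y (f : hom x y) (g : hom y x) : cmp f g = idm x -> g = inv f.
Proof. by move=> fg; apply: (@cmp_cancel_l _ _ _ f); rewrite fg cmp_invr. Qed.

Lemma inv_cmp x y z (f : hom x y) (g : hom y z) :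
  inv (cmp f g) = cmp (inv g) (inv f).
Proof. by apply/esym/inv_uniq; rewrite cmp_assoc cmpVKl cmp_invr. Qed.

End groupoid_theory.

Section equality_arrows.
Context {G : groupoid}.

(** Objects that are equal without being convertible are compared through these
    arrows, so that strict equalities of functors become equations between
    arrows of well-formed types and no cast along an equality is needed. *)
Definition eq_arrow (x y : G) (e : x = y) : hom x y :=
  match e in _ = z return hom x z with erefl => idm x end.

Lemma eq_arrow_id (x : G) (e : x = x) : eq_arrow e = idm x.
Proof. by rewrite (Prop_irrelevance e erefl). Qed.

Lemma eq_arrow_cat (x y z : G) (e : x = y) (e' : y = z) (e'' : x = z) :
  cmp (eq_arrow e) (eq_arrow e') = eq_arrow e''.
Proof. by subst z y; rewrite !eq_arrow_id cmp_idl. Qed.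

End equality_arrows.

Lemma functor_eq_natural (C D : groupoid) (F G : functor C D) : F = G ->
  forall (x y : C) (f : hom x y) (ex : F x = G x) (ey : F y = G y),
    cmp (fhom F f) (eq_arrow ey) = cmp (eq_arrow ex) (fhom G f).
Proof. by move=> <- x y f ex ey; rewrite !eq_arrow_id cmp_idl cmp_idr. Qed.

Lemma functor_ext (C D : groupoid) (F G : functor C D)
    (e : forall x, F x = G x) :
  (forall (x y : C) (f : hom x y),
    cmp (fhom F f) (eq_arrow (e y)) = cmp (eq_arrow (e x)) (fhom G f)) -> F = G.
Proof.
case: F G e => [Fo Fh F1 F2] [Go Gh G1 G2] /= e.
have eFG : Fo = Go by exact/funext.
subst Go => nat.
have hFG : Fh = Gh.
  apply: functional_extensionality_dep => x; apply: functional_extensionality_dep => y.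
  by apply/funext => f; have := nat x y f; rewrite !eq_arrow_id cmp_idl cmp_idr.
by subst Gh; congr Functor; exact: Prop_irrelevance.
Qed.

(** * Induction on subintervals *)

(** Connectedness of [0, 1] in the form used to cut curves: the supremum of the
    end points that can be reached from a is reached itself, and cannot be
    smaller than b, because the property holds on a neighbourhood of it.  This
    replaces Lebesgue numbers and explicit finite subdivisions. *)
Lemma interval_induction (R : realType) (P : R -> R -> Prop) :
  (forall a b c, 0 <= a -> a <= b -> b <= c -> c <= 1 ->
    P a b -> P b c -> P a c) ->
  (forall t, 0 <= t <= 1 -> exists2 e, 0 < e &
    forall a b, 0 <= a -> a <= b -> b <= 1 -> t - e < a -> b < t + e -> P a b) ->
  forall a b, 0 <= a -> a <= b -> b <= 1 -> P a b.
Proof.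
move=> Pcat Ploc a b a0 ab b1.
pose A := [set t | [/\ a <= t, t <= b & P a t]].
have Aa : A a.
  split=> //; have [|e e0 Pe] := Ploc a; first by lra.
  by apply: Pe; lra.
have Aub : ubound A b by move=> t [].
have supA : has_sup A by split; [exists a|exists b].
have as_ : a <= sup A by exact: sup_upper_bound.
have sb : sup A <= b by apply: ge_sup => //; exists a.
have [|e e0 Pe] := Ploc (sup A); first by lra.
have [t [at_ tb Pat] te] := sup_adherent e0 supA.
have ts : t <= sup A by exact: sup_upper_bound.
(* A point beyond the supremum, unless b is in the way. *)
pose c := Num.min b (sup A + e / 2).
have cb : c <= b by rewrite /c ge_min lexx.
have cs : c <= sup A + e / 2 by rewrite /c ge_min lexx orbT.
have sc : sup A <= c by rewrite /c le_min sb; lra.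
have Pac : P a c.
  by apply: (Pcat a t c) => //; [lra|lra|apply: Pe; lra].
have : c <= sup A by apply: sup_upper_bound => //; split => //; lra.
rewrite /c ge_min => /orP[bs|]; last by lra.
by have -> : b = c by apply/eqP; rewrite eq_le cb andbT; lra.
Qed.

Section clip.
Context {R : realType}.
Implicit Types a b t : R.

(** Retraction onto [a, b]: it makes a lift over a small interval the
    restriction of a lift defined on the whole line. *)
Definition clip a b t : R := Num.max a (Num.min b t).

Lemma clip_continuous a b : continuous (clip a b).
Proof.
apply: max_fun_continuous; first by move=> x; exact: cvg_cst.
by apply: min_fun_continuous => x; [exact: cvg_cst|exact: cvg_id].
Qed.

Lemma clip_itv a b t : a <= b -> a <= clip a b t <= b.
Proof. by move=> ab; rewrite /clip le_max lexx /= ge_max ab ge_min lexx. Qed.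

Lemma clip_id a b t : a <= t -> t <= b -> clip a b t = t.
Proof. by move=> at_ tb; rewrite /clip min_r // max_r. Qed.

End clip.

(** * Arcs of curves and their path classes *)

(** All points of X as objects, with X itself as type of objects: identities
    between arrows of an abstract groupoid then apply to path classes by
    conversion. *)
Definition path_groupoid (R : realType) (X : topologicalType) : groupoid :=
  {| obj := X;
     hom := path_class R;
     idm := @class_cst R X;
     cmp := @class_cat R X;
     inv := @class_rev R X;
     cmp_assoc := @class_cat_assoc R X;
     cmp_idl := @class_cat_cstl R X;
     cmp_idr := @class_cat_cstr R X;
     cmp_invr := @class_cat_revr R X;
     cmp_invl := @class_cat_revl R X |}.

Lemma class_catKl (R : realType) (X : topologicalType) (x y z : X)
    (a : path_class R x y) (b : path_class R y z) :
  class_cat (class_rev a) (class_cat a b) = b.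
Proof. exact: (@cmpKl (path_groupoid R X)). Qed.

Lemma class_catVKl (R : realType) (X : topologicalType) (x y z : X)
    (a : path_class R x y) (b : path_class R x z) :
  class_cat a (class_cat (class_rev a) b) = b.
Proof. exact: (@cmpVKl (path_groupoid R X)). Qed.

Lemma class_rev_cat (R : realType) (X : topologicalType) (x y z : X)
    (a : path_class R x y) (b : path_class R y z) :
  class_rev (class_cat a b) = class_cat (class_rev b) (class_rev a).
Proof. exact: (@inv_cmp (path_groupoid R X)). Qed.

Section arcs.
Context {R : realType} {X : topologicalType}.
Local Notation I := (unit_interval R).

Lemma segment_continuous (a b : R) :
  continuous (fun t : I => a + sval t * (b - a)).
Proof.
have -> : (fun t : I => a + sval t * (b - a)) = (fun t : I => (b - a) * sval t + a).
  by apply/funext => t; ring.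
by apply: scaled_continuous; exact: sval_continuous.
Qed.

Arguments segment_continuous : clear implicits.

Section arc.
Context (m : R -> X) (cm : continuous m) (a b : R).

Let arc_continuous : continuous (fun t : I => m (a + sval t * (b - a))).
Proof. exact: (Defs.comp_continuous cm (segment_continuous a b)). Qed.

Let arc_zero : m (a + sval (zero : I) * (b - a)) = m a.
Proof. by rewrite sval_zero mul0r addr0. Qed.

Let arc_one : m (a + sval (one : I) * (b - a)) = m b.
Proof. by rewrite sval_one mul1r addrC subrK. Qed.

Definition arc_path : {path I from m a to m b} :=
  mk_path arc_continuous arc_zero arc_one.

Lemma arc_pathE t : arc_path t = m (a + sval t * (b - a)).
Proof. by []. Qed.

End arc.

(** The plane is convex, so that a straight-line homotopy joins the two paths
    before they are mapped to X. *)
Lemma plane_homotopic (f : R * R -> X) (u v : I -> R * R) (x y : X)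
    (q r : {path I from x to y}) :
  continuous f -> continuous u -> continuous v ->
  u zero = v zero -> u one = v one ->
  (forall t, q t = f (u t)) -> (forall t, r t = f (v t)) ->
  path_homotopic q r.
Proof.
move=> cf cu cv uv0 uv1 qE rE.
pose mix (w w' : R) (s : I) : R := w + sval s * (w' - w).
pose h (z : I * I) : R * R :=
  (mix (u z.2).1 (v z.2).1 z.1, mix (u z.2).2 (v z.2).2 z.1).
have c1 : continuous (fun z : I * I => sval z.1 : R).
  by apply: sval_fun_continuous => z; exact: cvg_fst.
have c2 (w : I -> R) : continuous w -> continuous (fun z : I * I => w z.2).
  by move=> cw; apply: (Defs.comp_continuous cw) => z; exact: cvg_snd.
have cmix (w w' : I -> R) : continuous w -> continuous w' ->
    continuous (fun z : I * I => mix (w z.2) (w' z.2) z.1).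
  move=> cw cw' z; apply: cvgD; first exact: c2.
  apply: cvgM; first exact: c1.
  by apply: cvgB; exact: c2.
have cfst (w : I -> R * R) : continuous w -> continuous (fun t => (w t).1).
  by apply: Defs.comp_continuous => z; exact: cvg_fst.
have csnd (w : I -> R * R) : continuous w -> continuous (fun t => (w t).2).
  by apply: Defs.comp_continuous => z; exact: cvg_snd.
have ch : continuous h.
  by apply: pair_continuous;
    [apply: (cmix (fun t => (u t).1) (fun t => (v t).1)); exact: cfst
    |apply: (cmix (fun t => (u t).2) (fun t => (v t).2)); exact: csnd].
have mix0 w w' : mix w w' zero = w by rewrite /mix sval_zero mul0r addr0.
have mix1 w w' : mix w w' one = w' by rewrite /mix sval_one mul1r addrC subrK.
have mixx w s : mix w w s = w by rewrite /mix subrr mulr0 addr0.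
exists (f \o h); split.
- exact: (Defs.comp_continuous cf ch).
- by move=> t; rewrite qE /h /= !mix0 -surjective_pairing.
- by move=> t; rewrite rE /h /= !mix1 -surjective_pairing.
- move=> s; rewrite -(path_zero (s := q)) qE /h /= -uv0 !mixx.
  by rewrite -surjective_pairing.
- move=> s; rewrite -(path_one (s := q)) qE /h /= -uv1 !mixx.
  by rewrite -surjective_pairing.
Qed.

End arcs.

Arguments segment_continuous {R} a b.

Section slices.
Context {R : realType} {X : topologicalType}.

Lemma slice1_continuous (f : R * R -> X) s :
  continuous f -> continuous (fun t => f (s, t)).
Proof.
move=> cf; apply: (Defs.comp_continuous cf); apply: pair_continuous => z.
  exact: cvg_cst.
exact: cvg_id.
Qed.

Lemma slice2_continuous (f : R * R -> X) t :
  continuous f -> continuous (fun s => f (s, t)).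
Proof.
move=> cf; apply: (Defs.comp_continuous cf); apply: pair_continuous => z.
  exact: cvg_id.
exact: cvg_cst.
Qed.

End slices.

Arguments slice1_continuous {R X f} s cf.
Arguments slice2_continuous {R X f} t cf.

Section arc_classes.
Context {R : realType} {X : topologicalType}.
Local Notation I := (unit_interval R).

Let cid2 : continuous (fun z : R * R => z).
Proof. by move=> z; exact: cvg_id. Qed.

Lemma arc_cat (m : R -> X) (cm : continuous m) (a b c : R) :
  class_cat (class_of (arc_path cm a b)) (class_of (arc_path cm b c)) =
  class_of (arc_path cm a c).
Proof.
rewrite class_catE; apply/path_classP.
have h x := slice1_continuous x cid2.
apply: (@plane_homotopic _ _ (fun z => m z.2)
  (cat_path (arc_path (h 0) a b) (arc_path (h 0) b c)) (arc_path (h 0) a c)).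
- by apply: (Defs.comp_continuous cm) => z; exact: cvg_snd.
- exact: cts_fun.
- exact: cts_fun.
- by rewrite !path_zero.
- by rewrite !path_one.
- by move=> t; rewrite /= /mk_path /cat_fun; case: ifP.
- by [].
Qed.

Lemma arc_square (f : R * R -> X) (cf : continuous f) (s s' a b : R) :
  class_cat (class_of (arc_path (slice1_continuous s cf) a b))
            (class_of (arc_path (slice2_continuous b cf) s s')) =
  class_cat (class_of (arc_path (slice2_continuous a cf) s s'))
            (class_of (arc_path (slice1_continuous s' cf) a b)).
Proof.
rewrite !class_catE; apply/path_classP.
have h x := slice1_continuous x cid2.
have v x := slice2_continuous x cid2.
apply: (@plane_homotopic _ _ f
  (cat_path (arc_path (h s) a b) (arc_path (v b) s s'))
  (cat_path (arc_path (v a) s s') (arc_path (h s') a b))).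
- exact: cf.
- exact: cts_fun.
- exact: cts_fun.
- by rewrite !path_zero.
- by rewrite !path_one.
- by move=> t; rewrite /= /mk_path /cat_fun; case: ifP.
- by move=> t; rewrite /= /mk_path /cat_fun; case: ifP.
Qed.

(** The two halves are taken as restrictions of the path itself, so that
    whatever is known about the path pointwise passes to them. *)
Lemma path_split (x y : X) (q : {path I from x to y}) (c : R) : 0 <= c <= 1 ->
  exists (z : X) (q1 : {path I from x to z}) (q2 : {path I from z to y}),
    [/\ class_of q = class_cat (class_of q1) (class_of q2),
      forall t, q1 t = q (clamp (sval t * c)) &
      forall t, q2 t = q (clamp (c + sval t * (1 - c)))].
Proof.
move=> c01.
have cq : continuous (fun t : R => q (clamp t)).
  by apply: (Defs.comp_continuous _ clamp_continuous); exact: cts_fun.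
have c1 := Defs.comp_continuous cq (segment_continuous 0 c).
have c2 := Defs.comp_continuous cq (segment_continuous c 1).
have z1 : q (clamp (0 + sval (zero : I) * (c - 0))) = x.
  by rewrite sval_zero mul0r addr0; exact: path_zero.
have o1 : q (clamp (0 + sval (one : I) * (c - 0))) = q (clamp c).
  by rewrite sval_one mul1r add0r subr0.
have z2 : q (clamp (c + sval (zero : I) * (1 - c))) = q (clamp c).
  by rewrite sval_zero mul0r addr0.
have o2 : q (clamp (c + sval (one : I) * (1 - c))) = y.
  by rewrite sval_one mul1r addrC subrK; exact: path_one.
exists (q (clamp c)), (mk_path c1 z1 o1), (mk_path c2 z2 o2); split.
- rewrite class_catE; apply/path_classP.
  have ci : continuous (fun t : R => t) by move=> t; exact: cvg_id.
  pose v := cat_path (arc_path ci 0 c) (arc_path ci c 1).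
  apply: (@reparam_homotopic _ _ _ _ _ _ q id (fun t => clamp (v t))).
  + exact: cts_fun.
  + by move=> t; exact: cvg_id.
  + by apply: clamp_fun_continuous; exact: cts_fun.
  + by rewrite path_zero.
  + by rewrite path_one.
  + by [].
  + by move=> t; rewrite /= /mk_path /cat_fun; case: ifP.
- by move=> t; rewrite /= /mk_path add0r subr0.
- by [].
Qed.

End arc_classes.

(** * Local lifts *)

(** Composition with a local section: lifting is possible for every map with
    values in a small open set, whatever its source, which serves for curves
    and for homotopies alike. *)
Lemma local_lift (E B : topologicalType) (p : E -> B) :
  locally_sectionable p -> forall b, exists U : set B, [/\ open U, U b &
    forall (W : topologicalType) (g : W -> B), continuous g ->
      (forall w, U (g w)) ->
      exists2 f : W -> E, continuous f & forall w, p (f w) = g w].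
Proof.
move=> ls b; have [U [oU Ub [s [cs sK]]]] := ls b; exists U; split=> // W g cg Ug.
pose g' w : U := exist _ (g w) (mem_set (Ug w)).
exists (fun w => sval (s (g' w))).
  apply: (@Defs.comp_continuous _ _ _ (fun z : p @^-1` U => sval z)).
    exact: (@initial_continuous (p @^-1` U : Type) E set_val).
  apply: (Defs.comp_continuous cs).
  exact: (@to_set_type_continuous _ _ U g' cg).
by move=> w; have /(congr1 sval) := sK (g' w).
Qed.

Lemma locally_sectionable_surj (E B : topologicalType) (p : E -> B) :
  locally_sectionable p -> forall b, exists e, p e = b.
Proof.
move=> ls b; have [U [_ Ub [s [_ sK]]]] := ls b.
have /(congr1 sval) /= := sK (exist _ b (mem_set Ub)).
by exists (sval (s (exist _ b (mem_set Ub)))).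
Qed.

Lemma plane_local_lift (R : realType) (E B : topologicalType) (p : E -> B)
    (h : R * R -> B) (s0 t0 : R) :
  locally_sectionable p -> continuous h -> exists2 e : R, 0 < e &
    forall s s' a b, s <= s' -> a <= b -> s0 - e < s -> s' < s0 + e ->
      t0 - e < a -> b < t0 + e ->
      exists2 f : R * R -> E, continuous f &
        forall s1 t1, s <= s1 <= s' -> a <= t1 <= b -> p (f (s1, t1)) = h (s1, t1).
Proof.
move=> ls ch; have [U [oU Uh lift]] := local_lift ls (h (s0, t0)).
have : nbhs (s0, t0) (h @^-1` U) by apply: ch; exact: open_nbhs_nbhs.
case=> -[P Q] /= [/nbhs_ballP[e1 /= e10 Pe] /nbhs_ballP[e2 /= e20 Qe]] PQU.
exists (Num.min e1 e2); first by rewrite lt_min e10.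
move=> s s' a b ss' ab sl sr al bl.
have cr : continuous (fun z : R * R => (clip s s' z.1, clip a b z.2)).
  apply: pair_continuous; apply: (Defs.comp_continuous (@clip_continuous _ _ _)).
    by move=> z; exact: cvg_fst.
  by move=> z; exact: cvg_snd.
have [z|f cf fh] := lift _ _ (Defs.comp_continuous ch cr).
  have /andP[c1 c2] := clip_itv z.1 ss'; have /andP[c3 c4] := clip_itv z.2 ab.
  apply: (PQU (_, _)); split => /=.
    apply: Pe => /=; rewrite /ball /= ltr_norml.
    have : Num.min e1 e2 <= e1 by rewrite ge_min lexx.
    by move: (Num.min _ _) sl sr => e sl sr ee; lra.
  apply: Qe => /=; rewrite /ball /= ltr_norml.
  have : Num.min e1 e2 <= e2 by rewrite ge_min lexx orbT.
  by move: (Num.min _ _) al bl => e al bl ee; lra.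
exists f => // s1 t1 /andP[? ?] /andP[? ?].
by rewrite fh /= !clip_id.
Qed.

Lemma curve_local_lift (R : realType) (E B : topologicalType) (p : E -> B)
    (m : R -> B) (t0 : R) :
  locally_sectionable p -> continuous m -> exists2 e : R, 0 < e &
    forall a b, a <= b -> t0 - e < a -> b < t0 + e ->
      exists2 f : R -> E, continuous f & forall t, a <= t <= b -> p (f t) = m t.
Proof.
move=> ls cm.
have ch : continuous (fun z : R * R => m z.2).
  by apply: (Defs.comp_continuous cm) => z; exact: cvg_snd.
have [e e0 He] := plane_local_lift 0 t0 ls ch; exists e => // a b ab al br.
have [||f cf fh] := He 0 0 a b (lexx _) ab _ _ al br; [lra|lra|].
exists (fun t => f (0, t)); first exact: slice1_continuous.
by move=> t tab; rewrite fh // lexx.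
Qed.

(** * Transport along curves in the base *)

Section transport.
Context {R : realType} {E B : topologicalType} {p : E -> B} {L : groupoid}.
Local Notation I := (unit_interval R).
(* The equations p e = x and p e' = y are arguments of D in order that the
   values of D on two lifts of the same path have the same type. *)
Context (O : B -> L).
Context (D : forall (e e' : E) (a : path_class R e e') (x y : B),
  p e = x -> p e' = y -> hom (O x) (O y)).

(** The values obtained along m on [a, b] from some cutting and some lifts of
    the pieces.  A relation avoids choosing the cutting; that it is a function
    is [transport_exists] and [transport_unique].  The lift of a
    piece is parametrized by [0, 1] and not by the piece, which makes the
    relation stable under affine changes of the parameter. *)
Inductive transport (m : R -> B) : forall (a b : R) (x y : B),
    hom (O x) (O y) -> Prop :=
| transport_lift a b (e e' : E) (q : {path I from e to e'}) x y
    (hx : p e = x) (hy : p e' = y) :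
    a <= b -> (forall t, p (q t) = m (a + sval t * (b - a))) ->
    transport m a b (D (class_of q) hx hy)
| transport_cat a b c x y z (g : hom (O x) (O y)) (h : hom (O y) (O z)) :
    transport m a b g -> transport m b c h -> transport m a c (cmp g h).

Lemma transport_le (m : R -> B) (a b : R) x y (g : hom (O x) (O y)) :
  transport m a b g -> a <= b.
Proof. by elim=> // {a b x y g} a b c x y z g h _ ab _; exact: le_trans. Qed.

Lemma transport_ends (m : R -> B) (a b : R) x y (g : hom (O x) (O y)) :
  transport m a b g -> m a = x /\ m b = y.
Proof.
elim=> {a b x y g} [a b e e' q x y <- <- ab qm|a b c x y z g h _ [? _] _ [_ ?]] //.
have := qm zero; have := qm one.
rewrite path_zero path_one sval_zero sval_one mul0r addr0 mul1r addrC subrK.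
by move=> -> ->.
Qed.

Lemma transport_reparam (m m' : R -> B) (k l a b : R) x y (g : hom (O x) (O y)) :
  0 <= k -> (forall t, a <= t <= b -> m' (l + k * t) = m t) ->
  transport m a b g -> transport m' (l + k * a) (l + k * b) g.
Proof.
move=> k0 mm' T; elim: T mm' => {a b x y g}
    [a b e e' q x y hx hy ab qm|a b c x y z g h T1 IH1 T2 IH2] mm'.
  apply: transport_lift => [|t]; first by rewrite lerD2l ler_wpM2l.
  rewrite qm -mm'; first by congr m'; ring.
  have /andP[t0 t1] := unit_interval_itv t.
  by apply/andP; split; nra.
have ab := transport_le T1; have bc := transport_le T2.
apply: transport_cat; [apply: IH1|apply: IH2] => t /andP[? ?]; apply: mm'; lra.
Qed.

Lemma transport_arc (m : R -> B) (f : R -> E) (cf : continuous f) a b x y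
    (hx : p (f a) = x) (hy : p (f b) = y) : a <= b ->
  (forall t, a <= t <= b -> p (f t) = m t) ->
  transport m a b (D (class_of (arc_path cf a b)) hx hy).
Proof.
move=> ab fm; apply: transport_lift => // t; rewrite arc_pathE fm //.
by have /andP[t0 t1] := unit_interval_itv t; apply/andP; split; nra.
Qed.

Context (D_cat : forall (e f g : E) (a : path_class R e f) (b : path_class R f g)
  x y z (hx : p e = x) (hy : p f = y) (hz : p g = z),
  D (class_cat a b) hx hz = cmp (D a hx hy) (D b hy hz)).
Context (D_fibre : forall (e e' f f' : E) (q : {path I from e to e'})
  (r : {path I from f to f'}) x y (hx : p e = x) (hy : p e' = y)
  (hx' : p f = x) (hy' : p f' = y),
  (forall t, p (q t) = p (r t)) -> D (class_of q) hx hy = D (class_of r) hx' hy').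

(** Any cutting can be refined by one more point: this is what makes the values
    obtained from two cuttings comparable. *)
Lemma transport_split (m : R -> B) (a b c : R) x y (g : hom (O x) (O y)) :
  a <= c -> c <= b -> transport m a b g ->
  exists g1 : hom (O x) (O (m c)), exists2 g2 : hom (O (m c)) (O y),
    transport m a c g1 /\ transport m c b g2 & g = cmp g1 g2.
Proof.
move=> ac cb T; elim: T ac cb => {a b x y g}
    [a b e e' q x y hx hy ab qm|a b d x y z g h T1 IH1 T2 IH2] ac cb.
  (* The relative position of c in [a, b]; the interval may be a point. *)
  have [k k01 ck] : exists2 k, 0 <= k <= 1 & c = a + k * (b - a).
    have [ab'|ab'] := eqVneq a b.
      by exists 0; [rewrite lexx ler01|apply/eqP; rewrite eq_le; lra].
    have ba : 0 < b - a by rewrite subr_gt0 lt_neqAle ab' ab.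
    exists ((c - a) / (b - a)); last by rewrite divfK ?gt_eqF // addrC subrK.
    by rewrite divr_ge0 ?subr_ge0 //= ler_pdivrMr // mul1r lerD2r.
  have [f [q1 [q2 [-> q1E q2E]]]] := path_split q k01.
  have Ic (t : I) : 0 <= sval t * k <= 1.
    by have := unit_interval_itv t; move=> /andP[? ?]; apply/andP; split; nra.
  have Ic' (t : I) : 0 <= k + sval t * (1 - k) <= 1.
    by have := unit_interval_itv t; move=> /andP[? ?]; apply/andP; split; nra.
  have hf : p f = m c.
    rewrite -(path_one (s := q1)) q1E qm clampK // sval_one ck; congr m; ring.
  exists (D (class_of q1) hx hf), (D (class_of q2) hf hy); last exact: D_cat.
  split; apply: transport_lift => // t.
    by rewrite q1E qm clampK // ck; congr m; ring.
  by rewrite q2E qm clampK // ck; congr m; ring.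
have [cb'|cb'] := leP c b.
  have [g1 [g2 [? ?] ->]] := IH1 ac cb'.
  exists g1, (cmp g2 h); last by rewrite cmp_assoc.
  by split=> //; apply: transport_cat; eauto.
have [g1 [g2 [? ?] ->]] := IH2 (ltW cb') cb.
exists (cmp g g1), g2; last by rewrite cmp_assoc.
by split=> //; apply: transport_cat; eauto.
Qed.

(** Where m lifts as a whole, every cutting gives the value of the lift, since
    D only sees the image of a path in B. *)
Lemma transport_lifted (m : R -> B) (f : R -> E) (cf : continuous f)
    (a b u w : R) x y (g : hom (O x) (O y)) (hx : p (f u) = x) (hy : p (f w) = y) :
  (forall t, a <= t <= b -> p (f t) = m t) -> a <= u -> w <= b ->
  transport m u w g -> g = D (class_of (arc_path cf u w)) hx hy.
Proof.
move=> fm au wb T; elim: T au wb hx hy => {u w x y g}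
    [u w e e' q x y hx hy uw qm|u v w x y z g h T1 IH1 T2 IH2] au wb hx' hy'.
  apply: D_fibre => t; rewrite qm arc_pathE fm //.
  by have /andP[t0 t1] := unit_interval_itv t; apply/andP; split; nra.
have uv := transport_le T1; have vw := transport_le T2.
have hv : p (f v) = y.
  by rewrite fm; [exact: (transport_ends T1).2|apply/andP; split; lra].
rewrite (IH1 au _ hx' hv); last by lra.
rewrite (IH2 _ wb hv hy'); last by lra.
by rewrite -D_cat arc_cat.
Qed.

Context (ls : locally_sectionable p).

Lemma transport_exists (m : R -> B) (a b : R) :
  continuous m -> 0 <= a -> a <= b -> b <= 1 ->
  exists g : hom (O (m a)) (O (m b)), transport m a b g.
Proof.
move=> cm; move: a b; apply: interval_induction.
  by move=> a b c _ _ _ _ [g Tg] [h Th]; exists (cmp g h); exact: transport_cat Tg Th.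
move=> t _; have [e e0 lift] := curve_local_lift t ls cm; exists e => //.
move=> a b _ ab _ ta bt; have [f cf fm] := lift a b ab ta bt.
have ha : p (f a) = m a by rewrite fm // lexx.
have hb : p (f b) = m b by rewrite fm // lexx andbT.
by exists (D (class_of (arc_path cf a b)) ha hb); exact: transport_arc.
Qed.

Lemma transport_unique (m : R -> B) (a b : R) x y (g h : hom (O x) (O y)) :
  continuous m -> 0 <= a -> b <= 1 -> transport m a b g -> transport m a b h -> g = h.
Proof.
move=> cm a0 b1 Tg; have ab := transport_le Tg.
move: a b a0 ab b1 x y g h Tg.
apply: interval_induction.
  move=> a b c _ ab bc _ IH1 IH2 x y g h Tg Th.
  have [g1 [g2 [Tg1 Tg2] ->]] := transport_split ab bc Tg.
  have [h1 [h2 [Th1 Th2] ->]] := transport_split ab bc Th.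
  by rewrite (IH1 _ _ _ _ Tg1 Th1) (IH2 _ _ _ _ Tg2 Th2).
move=> t _; have [e e0 lift] := curve_local_lift t ls cm; exists e => //.
move=> a b _ ab _ ta bt x y g h Tg Th; have [f cf fm] := lift a b ab ta bt.
have [ma mb] := transport_ends Tg.
have ha : p (f a) = x by rewrite fm // lexx.
have hb : p (f b) = y by rewrite fm // lexx andbT.
rewrite (transport_lifted cf ha hb fm (lexx _) (lexx _) Tg).
by rewrite (transport_lifted cf ha hb fm (lexx _) (lexx _) Th).
Qed.

(** Transport along the boundary of [s, s'] x [a, b], the two ways from the
    corner (s, a) to the corner (s', b). *)
Definition square_commutes (h : R * R -> B) (s s' a b : R) : Prop :=
  forall x y x' y' (g : hom (O x) (O y)) (v : hom (O y) (O y'))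
    (u : hom (O x) (O x')) (g' : hom (O x') (O y')),
  transport (fun t => h (s, t)) a b g -> transport (fun t => h (t, b)) s s' v ->
  transport (fun t => h (t, a)) s s' u -> transport (fun t => h (s', t)) a b g' ->
  cmp g v = cmp u g'.

(** Commuting squares can be pasted in either direction, and a square that is
    small enough lifts to E, where the two ways are homotopic.  Induction on the
    second coordinate shows that thin strips commute, and induction on the first
    coordinate then stacks the strips. *)
Lemma square_commutesP h s s' a b : continuous h ->
  0 <= s -> s <= s' -> s' <= 1 -> 0 <= a -> a <= b -> b <= 1 ->
  square_commutes h s s' a b.
Proof.
move=> ch s0 ss' s1 a0 ab b1; move: s s' s0 ss' s1.
apply: interval_induction => [s r s' s0 sr rs' s1 C1 C2|s0 s01].
  move=> x y x' y' g v u g' Tg Tv Tu Tg'.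
  have [u1 [u2 [Tu1 Tu2] ->]] := transport_split sr rs' Tu.
  have [v1 [v2 [Tv1 Tv2] ->]] := transport_split sr rs' Tv.
  have [k Tk] := transport_exists (slice1_continuous r ch) a0 ab b1.
  rewrite -cmp_assoc (C1 _ _ _ _ _ _ _ _ Tg Tv1 Tu1 Tk).
  by rewrite !cmp_assoc (C2 _ _ _ _ _ _ _ _ Tk Tv2 Tu2 Tg').
have [e e0 He] : exists2 e, 0 < e & forall s s', 0 <= s -> s <= s' -> s' <= 1 ->
    s0 - e < s -> s' < s0 + e -> square_commutes h s s' a b.
  move: a b a0 ab b1.
  apply: interval_induction => [a b c a0 ab bc c1 [e1 e10 C1] [e2 e20 C2]|t0 t01].
    exists (Num.min e1 e2); first by rewrite lt_min e10.
    move=> s s' s0' ss' s1' sl sr.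
    have e1e : Num.min e1 e2 <= e1 by rewrite ge_min lexx.
    have e2e : Num.min e1 e2 <= e2 by rewrite ge_min lexx orbT.
    have {}C1 : square_commutes h s s' a b.
      by apply: C1 => //; move: (Num.min _ _) sl sr e1e => e *; lra.
    have {}C2 : square_commutes h s s' b c.
      by apply: C2 => //; move: (Num.min _ _) sl sr e2e => e *; lra.
    move=> x y x' y' g v u g' Tg Tv Tu Tg'.
    have [g1 [g2 [Tg1 Tg2] ->]] := transport_split ab bc Tg.
    have [g3 [g4 [Tg3 Tg4] ->]] := transport_split ab bc Tg'.
    have [k Tk] := transport_exists (slice2_continuous b ch) s0' ss' s1'.
    rewrite cmp_assoc (C2 _ _ _ _ _ _ _ _ Tg2 Tv Tk Tg4).
    by rewrite -cmp_assoc (C1 _ _ _ _ _ _ _ _ Tg1 Tk Tu Tg3) !cmp_assoc.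
  have [e e0 lift] := plane_local_lift s0 t0 ls ch; exists e => //.
  move=> a b a0 ab b1 al br; exists e => // s s' s0' ss' s1' sl sr.
  have [f cf fh] := lift s s' a b ss' ab sl sr al br.
  move=> x y x' y' g v u g' Tg Tv Tu Tg'.
  have ls' : s <= s <= s' by rewrite lexx.
  have rs' : s <= s' <= s' by rewrite lexx andbT.
  have la : a <= a <= b by rewrite lexx.
  have rb : a <= b <= b by rewrite lexx andbT.
  have [h1 h2] := transport_ends Tg; have [h3 h4] := transport_ends Tg'.
  have hx : p (f (s, a)) = x by rewrite fh.
  have hy : p (f (s, b)) = y by rewrite fh.
  have hx' : p (f (s', a)) = x' by rewrite fh.
  have hy' : p (f (s', b)) = y' by rewrite fh.
  rewrite (@transport_lifted _ _ (slice1_continuous s cf) _ _ _ _ _ _ _ hx hy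
    (fun t tab => fh s t ls' tab) (lexx _) (lexx _) Tg).
  rewrite (@transport_lifted _ _ (slice1_continuous s' cf) _ _ _ _ _ _ _ hx' hy'
    (fun t tab => fh s' t rs' tab) (lexx _) (lexx _) Tg').
  rewrite (@transport_lifted _ _ (slice2_continuous a cf) _ _ _ _ _ _ _ hx hx'
    (fun t tab => fh t a tab la) (lexx _) (lexx _) Tu).
  rewrite (@transport_lifted _ _ (slice2_continuous b cf) _ _ _ _ _ _ _ hy hy'
    (fun t tab => fh t b tab rb) (lexx _) (lexx _) Tv).
  by rewrite -!D_cat arc_square.
exists e => // s s' s0' ss' s1' sl sr; exact: He.
Qed.

Local Notation curve q := (fun t : R => q (clamp t)).

Lemma curve_continuous x y (q : {path I from x to y}) : continuous (curve q : R -> B).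
Proof.
by apply: (Defs.comp_continuous _ clamp_continuous); exact: cts_fun.
Qed.

Arguments curve_continuous {x y} q.

Lemma curve_transport_exists x y (q : {path I from x to y}) :
  exists g : hom (O x) (O y), transport (curve q) 0 1 g.
Proof.
have := transport_exists (curve_continuous q) (lexx _) ler01 (lexx _).
rewrite /=.
have -> : q (clamp 0) = x by exact: path_zero.
have -> : q (clamp 1) = y by exact: path_one.
by [].
Qed.

Lemma D_cst e x (hx : p e = x) : D (class_cst e) hx hx = idm (O x).
Proof. by apply: idempotent_idm; rewrite -D_cat class_cat_cstl. Qed.

Lemma transport_cst (m : R -> B) (a b : R) x (g : hom (O x) (O x)) :
  continuous m -> 0 <= a -> b <= 1 -> (forall t, m t = x) ->
  transport m a b g -> g = idm (O x).
Proof.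
move=> cm a0 b1 mx Tg; have [e ex] := locally_sectionable_surj ls x.
rewrite -(D_cst ex); apply: (transport_unique cm a0 b1 Tg).
by apply: (transport_lift _ _ (transport_le Tg)) => t; rewrite mx.
Qed.

(** In the square of a homotopy relative to the end points the two sides s = 0
    and s = 1 are q and r, and transport along the two constant sides is
    trivial. *)
Lemma curve_transport_homotopic x y (q r : {path I from x to y})
    (g h : hom (O x) (O y)) : path_homotopic q r ->
  transport (curve q) 0 1 g -> transport (curve r) 0 1 h -> g = h.
Proof.
move=> [H [cH H0 H1 Hx Hy]] Tg Th.
pose k (z : R * R) := H (clamp z.1, clamp z.2).
have ck : continuous k.
  apply: (Defs.comp_continuous cH).
  by apply: pair_continuous; apply: clamp_fun_continuous => z;
    [exact: cvg_fst|exact: cvg_snd].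
have kq : curve q = (fun t => k (0, t)) by apply/funext => t; rewrite -H0.
have kr : curve r = (fun t => k (1, t)) by apply/funext => t; rewrite -H1.
have kx s : k (s, 0) = x by exact: Hx.
have ky s : k (s, 1) = y by exact: Hy.
have const t z : (forall s, k (s, t) = z) ->
    transport (fun s => k (s, t)) 0 1 (idm (O z)).
  move=> kz; have ckt := slice2_continuous t ck.
  have [u Tu] : exists u : hom (O z) (O z), transport (fun s => k (s, t)) 0 1 u.
    have := transport_exists ckt (lexx _) ler01 (lexx _).
    by rewrite !kz.
  by rewrite -(transport_cst ckt (lexx _) (lexx _) kz Tu).
have := square_commutesP ck (lexx _) ler01 (lexx _) (lexx _) ler01 (lexx _).
rewrite kq in Tg; rewrite kr in Th.
move=> /(_ _ _ _ _ _ _ _ _ Tg (const _ _ ky) (const _ _ kx) Th).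
by rewrite cmp_idl cmp_idr.
Qed.

Definition descend x y (a : path_class R x y) : hom (O x) (O y) :=
  sval (cid (curve_transport_exists (repr a))).

Lemma descendE x y (q : {path I from x to y}) (g : hom (O x) (O y)) :
  transport (curve q) 0 1 g -> descend (class_of q) = g.
Proof.
move=> Tg; rewrite /descend; case: cid => h /= Th.
exact: curve_transport_homotopic (path_class_reprK q) Th Tg.
Qed.

Lemma descend_lift (e e' : E) (q : {path I from e to e'}) x y
    (r : {path I from x to y}) (hx : p e = x) (hy : p e' = y) :
  (forall t, p (q t) = r t) -> descend (class_of r) = D (class_of q) hx hy.
Proof.
move=> qr; apply: descendE; apply: transport_lift => // t.
by rewrite subr0 mulr1 add0r svalK.
Qed.

Lemma descend_cat x y z (a : path_class R x y) (b : path_class R y z) :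
  descend (class_cat a b) = cmp (descend a) (descend b).
Proof.
rewrite -[a]class_ofK -[b]class_ofK class_catE; move: (repr a) (repr b) => q r.
have [g Tg] := curve_transport_exists q; have [h Th] := curve_transport_exists r.
rewrite (descendE Tg) (descendE Th); apply: descendE.
(* The two halves of the concatenation are q at double speed on [0, 1/2] and r
   at double speed on [1/2, 1]. *)
have Tq : transport (curve (cat_path q r)) (0 + 2^-1 * 0) (0 + 2^-1 * 1) g.
  apply: (transport_reparam _ _ Tg) => [|t t01]; first by lra.
  rewrite /= /mk_path /cat_fun /affine clampK; last by lra.
  rewrite ifT; last by lra.
  by congr (q (clamp _)); field.
have Tr : transport (curve (cat_path q r)) (2^-1 + 2^-1 * 0) (2^-1 + 2^-1 * 1) h.
  apply: (transport_reparam _ _ Th) => [|t t01]; first by lra.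
  rewrite /= /mk_path /cat_fun /affine clampK; last by lra.
  case: ifPn => th; last by congr (r (clamp _)); field.
  have -> : t = 0 by lra.
  transitivity y; last by exact/esym/(path_zero (s := r)).
  by rewrite -[RHS](path_one (s := q)); congr (q (clamp _)); field.
have two : 2^-1 + 2^-1 = 1 :> R by field.
rewrite mulr0 mulr1 addr0 add0r in Tq; rewrite mulr0 mulr1 addr0 two in Tr.
exact: transport_cat Tq Tr.
Qed.

End transport.

Arguments descend {R E B p L O} D ls {x y} a.
Arguments descend_lift {R E B p L O D} D_cat D_fibre ls {e e' q x y r} hx hy qr.
Arguments descend_cat {R E B p L O D} D_cat D_fibre ls {x y z} a b.
Arguments curve_continuous {R B x y} q.

(** * Paths that agree in the base *)

Definition set_point (T : Type) (A : set T) (x : T) (Ax : A x) : A :=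
  exist _ x (mem_set Ax).

Section fibre_equal.
Context {R : realType} {E E' B : topologicalType} (p : E -> B) (p' : E' -> B).
Local Notation I := (unit_interval R).

(** The two representatives form a path of the fibre product of p and p'; when p'
    is the identity of B, this says that a lifts b. *)
Definition fibre_equal (e e' : E) (f f' : E') (a : path_class R e e')
    (b : path_class R f f') : Prop :=
  exists (q : {path I from e to e'}) (r : {path I from f to f'}),
    [/\ a = class_of q, b = class_of r & forall t, p (q t) = p' (r t)].

Lemma fibre_equal_ends e e' f f' (a : path_class R e e') (b : path_class R f f') :
  fibre_equal a b -> p e = p' f /\ p e' = p' f'.
Proof.
move=> [q [r [_ _ qr]]]; split.
  by rewrite -(path_zero (s := q)) -(path_zero (s := r)).
by rewrite -(path_one (s := q)) -(path_one (s := r)).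
Qed.

Lemma fibre_equal_cst e f : p e = p' f ->
  fibre_equal (class_cst e) (class_cst f).
Proof. by move=> ef; exists (cst e), (cst f). Qed.

Lemma fibre_equal_cat e e' e'' f f' f'' (a : path_class R e e')
    (a' : path_class R e' e'') (b : path_class R f f') (b' : path_class R f' f'') :
  fibre_equal a b -> fibre_equal a' b' ->
  fibre_equal (class_cat a a') (class_cat b b').
Proof.
move=> [q [r [-> -> qr]]] [q' [r' [-> -> qr']]].
exists (cat_path q q'), (cat_path r r'); split; rewrite ?class_catE // => t.
by rewrite /= /mk_path /cat_fun; case: ifP.
Qed.

Lemma fibre_equal_rev e e' f f' (a : path_class R e e') (b : path_class R f f') :
  fibre_equal a b -> fibre_equal (class_rev a) (class_rev b).
Proof.
move=> [q [r [-> -> qr]]].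
by exists (rev_path q), (rev_path r); split; rewrite ?class_revE // => t; exact: qr.
Qed.

End fibre_equal.

Section fibre_paths.
Context {R : realType} {E B : topologicalType} (p : continuousType E B) (S : set B).
Local Notation I := (unit_interval R).
Local Notation EE := (fibre_product p p).
Local Notation A := (p @^-1` S).

Definition fp_point (e f : E) (h : p e = p f) : EE := exist _ (e, f) (mem_set h).

Section pair_path.
Context (e e' f f' : E) (he : p e = p f) (he' : p e' = p f').
Context (q : {path I from e to e'}) (r : {path I from f to f'}).
Context (qr : forall t, p (q t) = p (r t)).

Let pair_fun (t : I) : EE := fp_point (qr t).

Let pair_continuous : continuous pair_fun.
Proof.
apply: (@to_set_type_continuous _ _ [set z : E * E | p z.1 = p z.2]).
by apply: Defs.pair_continuous; exact: cts_fun.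
Qed.

Let pair_zero : pair_fun zero = fp_point he.
Proof. by apply: val_inj; rewrite /= !path_zero. Qed.

Let pair_one : pair_fun one = fp_point he'.
Proof. by apply: val_inj; rewrite /= !path_one. Qed.

Definition pair_path : {path I from fp_point he to fp_point he'} :=
  mk_path pair_continuous pair_zero pair_one.

End pair_path.

(** The hypothesis on path components, projected to the three factors. *)
Lemma triple_paths : meets_path_components R (fp_base (fp_base p p) p @^-1` S) ->
  forall e f g : E, p e = p f -> p f = p g ->
  exists (x y z : A) (a : path_class R e (sval x)) (b : path_class R f (sval y))
    (c : path_class R g (sval z)),
    [/\ p (sval x) = p (sval y), p (sval y) = p (sval z),
      fibre_equal p p a b, fibre_equal p p b c & fibre_equal p p a c].
Proof.
move=> meets e f g ef fg.
have h : fp_base p p (fp_point ef) = p g by rewrite /fp_base /= ef.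
pose pt : fibre_product (fp_base p p) p := exist _ (fp_point ef, g) (mem_set h).
have [w [[q] Sw]] := meets pt.
have ab (v : EE) : p (fst_proj p p v) = p (snd_proj p p v) := fp_baseE v.
have bc (v : fibre_product (fp_base p p) p) :
    p (fst_proj p p (fst_proj _ _ v)) = p (snd_proj _ _ v) := fp_baseE v.
have Sx : A (fst_proj p p (fst_proj _ _ w)) := Sw.
have Sy : A (snd_proj p p (fst_proj _ _ w)) by rewrite /preimage /= -ab.
have Sz : A (snd_proj _ _ w) by rewrite /preimage /= -bc.
exists (set_point Sx), (set_point Sy), (set_point Sz).
pose q12 := (fst_proj (fp_base p p) p \o q
  : {path I from fst_proj _ _ pt to fst_proj _ _ w}).
pose qa := (fst_proj p p \o q12
  : {path I from fst_proj p p (fst_proj _ _ pt) to fst_proj p p (fst_proj _ _ w)}).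
pose qb := (snd_proj p p \o q12
  : {path I from snd_proj p p (fst_proj _ _ pt) to snd_proj p p (fst_proj _ _ w)}).
pose qc := (snd_proj (fp_base p p) p \o q
  : {path I from snd_proj _ _ pt to snd_proj _ _ w}).
exists (class_of qa), (class_of qb), (class_of qc); split.
- exact: ab.
- by rewrite -ab bc.
- by exists qa, qb; split=> // t; exact: ab.
- by exists qb, qc; split=> // t; rewrite /= -ab bc.
- by exists qa, qc; split=> // t; rewrite /= bc.
Qed.

Lemma pair_paths : meets_path_components R (fp_base (fp_base p p) p @^-1` S) ->
  forall e f : E, p e = p f ->
  exists (x y : A) (a : path_class R e (sval x)) (b : path_class R f (sval y)),
    fibre_equal p p a b.
Proof.
move=> meets e f ef.
have [x [y [z [a [b [c [_ _ ab _ _]]]]]]] := triple_paths meets ef (erefl (p f)).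
by exists x, y, a, b.
Qed.

Section coequalized.
Context {L : groupoid} (F : functor (pi1 R A) L).
Context (Fab : comp_functor F (pi1_map R (fst_proj p p) (@fst_proj_over _ _ _ p p S)
      : functor (pi1 R (fp_base p p @^-1` S)) (pi1 R A)) =
  comp_functor F (pi1_map R (snd_proj p p) (@snd_proj_over _ _ _ p p S))).

Lemma coequalized_obj (g h : A) : p (sval g) = p (sval h) -> F g = F h.
Proof.
case: g h => [g Ag] [h Ah] /= gh.
have Sz : (fp_base p p @^-1` S) (fp_point gh) by exact: (set_mem Ag).
have := congr1 (fun K : functor (pi1 R (fp_base p p @^-1` S)) L =>
  K (exist _ (fp_point gh) (mem_set Sz))) Fab.
rewrite /=.
set Ag' := mem_set (fst_proj_over _); set Ah' := mem_set (snd_proj_over _).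
by rewrite (Prop_irrelevance Ag' Ag) (Prop_irrelevance Ah' Ah).
Qed.

(** A pair of paths with the same image is a path of E x_B E, on which F takes
    the same value through both projections. *)
Lemma coequalized_natural (g g' h h' : A) (a : path_class R (sval g) (sval g'))
    (b : path_class R (sval h) (sval h')) (e : F g = F h) (e' : F g' = F h') :
  fibre_equal p p a b ->
  cmp (fhom F (a : @hom (pi1 R A) g g')) (eq_arrow e') =
  cmp (eq_arrow e) (fhom F (b : @hom (pi1 R A) h h')).
Proof.
move=> ab; have [gh gh'] := fibre_equal_ends ab.
case: ab => q [r [-> -> qr]].
case: g g' h h' {a b} e e' q r qr gh gh' =>
  [g Ag] [g' Ag'] [h Ah] [h' Ah'] /= e e' q r qr gh gh'.
pose P := fp_base p p @^-1` S.
have Sz : P (fp_point gh) by exact: (set_mem Ag).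
have Sz' : P (fp_point gh') by exact: (set_mem Ag').
pose z : pi1 R P := exist _ (fp_point gh) (mem_set Sz).
pose z' : pi1 R P := exist _ (fp_point gh') (mem_set Sz').
move: (@functor_eq_natural _ _ _ _ Fab z z' (class_of (pair_path gh gh' qr))).
rewrite /comp_functor /=.
set Bg := mem_set (@fst_proj_over _ _ _ _ _ S (fp_point gh) _).
set Bh := mem_set (@snd_proj_over _ _ _ _ _ S (fp_point gh) _).
set Bg' := mem_set (@fst_proj_over _ _ _ _ _ S (fp_point gh') _).
set Bh' := mem_set (@snd_proj_over _ _ _ _ _ S (fp_point gh') _).
rewrite (Prop_irrelevance Bg Ag) (Prop_irrelevance Bh Ah).
rewrite (Prop_irrelevance Bg' Ag') (Prop_irrelevance Bh' Ah').
move=> /(_ e e') nat.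
have qE : class_of q = class_map (fst_proj p p) (class_of (pair_path gh gh' qr)).
  by rewrite class_mapE; congr class_of; exact/path_eqP.
have rE : class_of r = class_map (snd_proj p p) (class_of (pair_path gh gh' qr)).
  by rewrite class_mapE; congr class_of; exact/path_eqP.
rewrite qE rE; exact: nat.
Qed.

End coequalized.
End fibre_paths.

(** * Descending a functor from the total space *)

Section descent.
Context {R : realType} {E B : topologicalType} (p : continuousType E B) (S : set B).
Local Notation I := (unit_interval R).
Local Notation A := (p @^-1` S).
Context {L : groupoid} (F : functor (pi1 R A) L).

(** The value of F on the path that goes back along u and then along v.  The
    point e itself need not lie over S; only the ends of u and v do. *)
Definition between (e : E) (g h : A) (u : path_class R e (sval g))
    (v : path_class R e (sval h)) : hom (F g) (F h) :=
  fhom F (class_cat (class_rev u) v : @hom (pi1 R A) g h).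

Lemma between_cat e (g h k : A) (u : path_class R e (sval g))
    (v : path_class R e (sval h)) (w : path_class R e (sval k)) :
  cmp (between u v) (between v w) = between u w.
Proof.
rewrite /between -fhom_cmp /=; congr (fhom F _).
by rewrite class_cat_assoc class_catVKl.
Qed.

Lemma between_catA e (g h k : A) (z : L) (u : path_class R e (sval g))
    (v : path_class R e (sval h)) (w : path_class R e (sval k)) (f : hom (F k) z) :
  cmp (between u v) (cmp (between v w) f) = cmp (between u w) f.
Proof. by rewrite -cmp_assoc between_cat. Qed.

Lemma between_id e (g : A) (u : path_class R e (sval g)) :
  between u u = idm (F g).
Proof. by rewrite /between class_cat_revl; exact: (@fhom_idm _ _ F g). Qed.

Lemma between_inv e (g h : A) (u : path_class R e (sval g))
    (v : path_class R e (sval h)) : inv (between u v) = between v u.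
Proof. by apply/esym/inv_uniq; rewrite between_cat between_id. Qed.

Lemma between_catl e f (g h : A) (a : path_class R e f)
    (u : path_class R f (sval g)) (v : path_class R f (sval h)) :
  between (class_cat a u) (class_cat a v) = between u v.
Proof. by rewrite /between class_rev_cat class_cat_assoc class_catKl. Qed.

Lemma between_cst (g h : A) (v : path_class R (sval g) (sval h)) :
  between (class_cst (sval g)) v = fhom F (v : @hom (pi1 R A) g h).
Proof.
rewrite /between; congr (fhom F _).
by rewrite -[in RHS](class_catKl (class_cst (sval g)) v) class_cat_cstl.
Qed.

Context (Fab : comp_functor F (pi1_map R (fst_proj p p) (@fst_proj_over _ _ _ p p S)
      : functor (pi1 R (fp_base p p @^-1` S)) (pi1 R A)) =
  comp_functor F (pi1_map R (snd_proj p p) (@snd_proj_over _ _ _ p p S))).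

Lemma between_fibre (e e' : E) (g h g' h' : A) (u : path_class R e (sval g))
    (v : path_class R e (sval h)) (u' : path_class R e' (sval g'))
    (v' : path_class R e' (sval h')) (eg : F g = F g') (eh : F h = F h') :
  fibre_equal p p u u' -> fibre_equal p p v v' ->
  cmp (between u v) (eq_arrow eh) = cmp (eq_arrow eg) (between u' v').
Proof.
move=> uu vv; apply: (coequalized_natural Fab).
by apply: fibre_equal_cat => //; exact: fibre_equal_rev.
Qed.

Context (ls : locally_sectionable p).
Context (meets : meets_path_components R (fp_base (fp_base p p) p @^-1` S)).

(* In each fibre a reference point, with a path that leads from it to a point
   over S. *)
Let anchor_exists (b : B) :
  exists z : {e : E & {g : A & path_class R e (sval g)}}, p (tag z) = b.
Proof.
have [e eb] := locally_sectionable_surj ls b.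
have [g [_ [c _]]] := pair_paths meets (erefl (p e)).
by exists (existT _ e (existT _ g c)).
Qed.

Let anchor (b : B) := sval (cid (anchor_exists b)).
Let anchor_pt b : E := tag (anchor b).
Let anchor_end b : A := tag (tagged (anchor b)).
Let anchor_path b : path_class R (anchor_pt b) (sval (anchor_end b)) :=
  tagged (tagged (anchor b)).
Let anchorE b : p (anchor_pt b) = b.
Proof. exact: (svalP (cid (anchor_exists b))). Qed.

Definition anchor_obj (b : B) : L := F (anchor_end b).

(** A way of comparing a point e over b with the fibre of b as a whole: a path
    from e to a point over S, and an arrow from the value of F there to the
    object attached to b. *)
Record leg (e : E) (b : B) := Leg {
  leg_end : A;
  leg_path : path_class R e (sval leg_end);
  leg_arrow : hom (F leg_end) (anchor_obj b) }.

(** The legs that come from moving e and the reference point of its fibre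
    together to points over S. *)
Definition proper_leg e b (l : leg e b) : Prop :=
  exists (h : A) (c : path_class R (anchor_pt b) (sval h)) (eh : F (leg_end l) = F h),
    fibre_equal p p (leg_path l) c /\
    leg_arrow l = cmp (eq_arrow eh) (between c (anchor_path b)).

(** Moving e, f and the reference point simultaneously gives legs of e and f
    that differ by an equality of objects only. *)
Lemma two_legs e f b : p e = b -> p f = b ->
  exists (l : leg e b) (k : leg f b), [/\ proper_leg l, proper_leg k,
    fibre_equal p p (leg_path l) (leg_path k) &
    exists eh : F (leg_end l) = F (leg_end k),
      leg_arrow l = cmp (eq_arrow eh) (leg_arrow k)].
Proof.
move=> eb fb.
have ef : p e = p f by rewrite eb.
have fa : p f = p (anchor_pt b) by rewrite anchorE.
have [x [y [z [a [c [d [xy yz ac cd ad]]]]]]] := triple_paths meets ef fa.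
have exy := coequalized_obj Fab xy.
have eyz := coequalized_obj Fab yz.
have exz := coequalized_obj Fab (etrans xy yz).
exists (@Leg e b x a (cmp (eq_arrow exz) (between d (anchor_path b)))).
exists (@Leg f b y c (cmp (eq_arrow eyz) (between d (anchor_path b)))).
split=> //=.
- by exists z, d, exz.
- by exists z, d, eyz.
- by exists exy; rewrite -cmp_assoc (eq_arrow_cat _ _ exz).
Qed.

(** Two moves of the pair formed by e and its reference point differ by a path
    of E x_B E between points over S, on which both projections have the same
    value. *)
Lemma proper_leg_unique e b (l k : leg e b) : proper_leg l -> proper_leg k ->
  cmp (between (leg_path l) (leg_path k)) (leg_arrow k) = leg_arrow l.
Proof.
move=> [h [c [eh [lc ->]]]] [h' [c' [eh' [kc' ->]]]].
by rewrite -cmp_assoc (between_fibre eh eh' lc kc') cmp_assoc between_cat.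
Qed.

Definition leg_conj e e' x y (l : leg e x) (k : leg e' y) (a : path_class R e e') :
    hom (anchor_obj x) (anchor_obj y) :=
  cmp (inv (leg_arrow l))
    (cmp (between (leg_path l) (class_cat a (leg_path k))) (leg_arrow k)).

Lemma leg_conj_unique e e' x y (l l' : leg e x) (k k' : leg e' y)
    (a : path_class R e e') : proper_leg l -> proper_leg l' ->
  proper_leg k -> proper_leg k' -> leg_conj l k a = leg_conj l' k' a.
Proof.
move=> pl pl' pk pk'; rewrite /leg_conj -(proper_leg_unique pl pl').
rewrite -(proper_leg_unique pk pk') inv_cmp between_inv -(between_catl a (leg_path k)).
by rewrite !cmp_assoc !between_catA.
Qed.

Lemma proper_leg_exists e b : p e = b -> exists l : leg e b, proper_leg l.
Proof. by move=> eb; have [l [_ [pl _ _ _]]] := two_legs eb eb; exists l. Qed.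

Definition the_leg e b (eb : p e = b) : leg e b := sval (cid (proper_leg_exists eb)).

Lemma the_leg_proper e b (eb : p e = b) : proper_leg (the_leg eb).
Proof. exact: (svalP (cid (proper_leg_exists eb))). Qed.

Definition lift_value (e e' : E) (a : path_class R e e') (x y : B)
    (hx : p e = x) (hy : p e' = y) : hom (anchor_obj x) (anchor_obj y) :=
  leg_conj (the_leg hx) (the_leg hy) a.

Lemma lift_value_cat (e f g : E) (a : path_class R e f) (b : path_class R f g)
    x y z (hx : p e = x) (hy : p f = y) (hz : p g = z) :
  lift_value (class_cat a b) hx hz = cmp (lift_value a hx hy) (lift_value b hy hz).
Proof.
rewrite /lift_value /leg_conj !cmp_assoc cmpVKl; congr cmp.
by rewrite -(between_catl a (leg_path (the_leg hy))) between_catA class_cat_assoc.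
Qed.

(** Legs of the two lifts may be chosen, at either end, as parts of one triple
    move; the two values then agree by the hypothesis on F. *)
Lemma lift_value_fibre (e e' f f' : E) (q : {path I from e to e'})
    (r : {path I from f to f'}) x y (hx : p e = x) (hy : p e' = y)
    (hx' : p f = x) (hy' : p f' = y) : (forall t, p (q t) = p (r t)) ->
  lift_value (class_of q) hx hy = lift_value (class_of r) hx' hy'.
Proof.
move=> qr.
have [l [k [pl pk lk [elk lkE]]]] := two_legs hx hx'.
have [l' [k' [pl' pk' lk' [elk' lkE']]]] := two_legs hy hy'.
rewrite /lift_value.
rewrite (leg_conj_unique _ (the_leg_proper hx) pl (the_leg_proper hy) pl').
rewrite (leg_conj_unique _ (the_leg_proper hx') pk (the_leg_proper hy') pk').
rewrite /leg_conj lkE lkE' inv_cmp -(cmp_assoc (between _ _)).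
rewrite (between_fibre elk elk' lk (v' := class_cat (class_of r) (leg_path k'))).
  by rewrite !cmp_assoc cmpKl.
by apply: fibre_equal_cat => //; exists q, r.
Qed.

Local Notation down := (descend lift_value ls).

(** When the starting point of the leg lies over S, F is defined on its path:
    the leg becomes an arrow of L, and these arrows compare F with
    [lift_value]. *)
Definition leg_hom (g : A) b (l : leg (sval g) b) : hom (F g) (anchor_obj b) :=
  cmp (between (class_cst (sval g)) (leg_path l)) (leg_arrow l).

Lemma leg_hom_unique (g : A) b (l k : leg (sval g) b) :
  proper_leg l -> proper_leg k -> leg_hom l = leg_hom k.
Proof.
move=> pl pk; rewrite /leg_hom -(proper_leg_unique pl pk).
by rewrite -cmp_assoc between_cat.
Qed.

Lemma leg_hom_fibre (g h : A) b (hg : p (sval g) = b) (hh : p (sval h) = b)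
    (e : F g = F h) :
  leg_hom (the_leg hg) = cmp (eq_arrow e) (leg_hom (the_leg hh)).
Proof.
have [l [k [pl pk lk [elk lkE]]]] := two_legs hg hh.
rewrite (leg_hom_unique (the_leg_proper hg) pl).
rewrite (leg_hom_unique (the_leg_proper hh) pk).
rewrite /leg_hom lkE -!cmp_assoc; congr cmp; apply: between_fibre => //.
by apply: fibre_equal_cst; rewrite hg hh.
Qed.

Lemma lift_value_leg_hom (g h : A) (a : path_class R (sval g) (sval h)) x y
    (hx : p (sval g) = x) (hy : p (sval h) = y) :
  cmp (leg_hom (the_leg hx)) (lift_value a hx hy) =
  cmp (fhom F (a : @hom (pi1 R A) g h)) (leg_hom (the_leg hy)).
Proof.
rewrite /lift_value /leg_conj /leg_hom !cmp_assoc cmpVKl between_catA.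
rewrite -between_cst -(between_catl a (class_cst _)) class_cat_cstr.
by rewrite between_catA.
Qed.

(* F takes equal values at all points over s, so that any choice of a point
   makes the composite with p strictly equal to F on objects. *)
Let section_exists (s : S) : exists g : A, p (sval g) = sval s.
Proof.
have [e es] := locally_sectionable_surj ls (sval s).
have Se : A e by rewrite /preimage /= es; exact: (set_mem (svalP s)).
by exists (set_point Se).
Qed.

Let sigma (s : S) : A := sval (cid (section_exists s)).
Let sigmaE s : p (sval (sigma s)) = sval s.
Proof. exact: (svalP (cid (section_exists s))). Qed.

Let glue_obj (s : pi1 R S) : L := F (sigma s).

Let glue_hom (s t : pi1 R S) (a : hom s t) : hom (glue_obj s) (glue_obj t) :=
  cmp (leg_hom (the_leg (sigmaE s)))
    (cmp (down a) (inv (leg_hom (the_leg (sigmaE t))))).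

Let glue_hom_cmp s t u (a : hom s t) (b : hom t u) :
  glue_hom (cmp a b) = cmp (glue_hom a) (glue_hom b).
Proof.
rewrite /glue_hom /= (descend_cat lift_value_cat lift_value_fibre ls).
move: (leg_hom _) (leg_hom _) (leg_hom _) => k l m.
by rewrite !cmp_assoc cmpKl.
Qed.

Let glue_hom_idm s : glue_hom (idm s) = idm (glue_obj s).
Proof. by apply: idempotent_idm; rewrite -glue_hom_cmp cmp_idl. Qed.

Definition glued_functor : functor (pi1 R S) L := Functor glue_hom_idm glue_hom_cmp.

Lemma glued_functorK : comp_functor glued_functor (pi1_map R p (@map_over _ _ p S)
  : functor (pi1 R A) (pi1 R S)) = F.
Proof.
pose c : functor (pi1 R A) (pi1 R S) := pi1_map R p (@map_over _ _ p S).
have e (g : A) : glued_functor (c g) = F g.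
  by apply: (coequalized_obj Fab); rewrite sigmaE.
apply: (@functor_ext _ _ (comp_functor glued_functor c) F e) => g h a.
rewrite -[a]class_ofK; move: (repr a) => q /=.
rewrite /glue_hom class_mapE.
rewrite (descend_lift lift_value_cat lift_value_fibre ls (q := q)
  (erefl (p (sval g))) (erefl (p (sval h)))) //.
rewrite (leg_hom_fibre _ (erefl (p (sval g))) (e g)).
rewrite (leg_hom_fibre _ (erefl (p (sval h))) (e h)).
have := lift_value_leg_hom (class_of q) (erefl (p (sval g))) (erefl (p (sval h))).
move: (leg_hom _) (leg_hom _) (lift_value _ _ _) => k l v kv.
rewrite inv_cmp !cmp_assoc cmp_invl cmp_idr; congr cmp.
by rewrite -cmp_assoc kv cmp_assoc cmp_invr cmp_idr.
Qed.

End descent.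

(** * Generation by images of paths of the total space *)

Section generation.
Context {R : realType} {E B : topologicalType} (p : continuousType E B) (S : set B).
Local Notation I := (unit_interval R).
Local Notation lifts a h := (fibre_equal p (fun b : B => b) a h).

Lemma fibre_equal_image (e e' f f' : E) (a : path_class R e e')
    (b : path_class R f f') (x : B) : p e = x -> fibre_equal p p a b ->
  exists h : path_class R x (p e'), lifts a h /\ lifts b h.
Proof.
move=> <- ab; have [ef ef'] := fibre_equal_ends ab.
case: ab => q [r [-> -> qr]].
pose pq := (p \o q : {path I from p e to p e'}).
by exists (class_of pq); split; [exists q, pq|exists r, pq; split=> // t; rewrite -qr].
Qed.

Context (ls : locally_sectionable p).
Context (meets : meets_path_components R (fp_base (fp_base p p) p @^-1` S)).

Context (W : forall x y : B, path_class R x y -> Prop).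
Context (W_cat : forall x y z (a : path_class R x y) (b : path_class R y z),
  S x -> S y -> S z -> W a -> W b -> W (class_cat a b)).
Context (W_image : forall e e' (a : path_class R e e'),
  S (p e) -> S (p e') -> W (class_map p a)).

Let W_lifts e e' (a : path_class R e e') x y (h : path_class R x y) :
  S x -> S y -> lifts a h -> W h.
Proof.
move=> Sx Sy ah; have [ex ey] := fibre_equal_ends ah; subst x y.
case: ah => q [r [_ -> qr]].
have -> : class_of r = class_map p (class_of q).
  by rewrite class_mapE; congr class_of; apply/path_eqP => t; exact/esym/qr.
exact: W_image.
Qed.

(* The end points of a piece are arbitrary; the family W is tested on the piece
   completed by liftable detours from its end points to S. *)
Let joined (x y : B) (h : path_class R x y) : Prop :=
  forall z w (k : path_class R x z) (l : path_class R y w) e e' f f'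
    (c : path_class R e e') (d : path_class R f f'),
  S z -> S w -> lifts c k -> lifts d l ->
  W (class_cat (class_rev k) (class_cat h l)).

Let joined_cat x y z (a : path_class R x y) (b : path_class R y z) :
  joined a -> joined b -> joined (class_cat a b).
Proof.
move=> Ja Jb u w k l e e' f f' c d Su Sw ck dl.
have [g gy] := locally_sectionable_surj ls y.
have [v [_ [m _]]] := pair_paths meets (erefl (p g)).
have mm : fibre_equal p p m m by exists (repr m), (repr m); rewrite class_ofK.
have [n [mn _]] := fibre_equal_image gy mm.
have Sv : S (p (sval v)) := set_mem (svalP v).
have := W_cat Su Sv Sw (Ja _ _ _ _ _ _ _ _ _ _ Su Sv ck mn)
  (Jb _ _ _ _ _ _ _ _ _ _ Sv Sw mn dl).
by rewrite !class_cat_assoc class_catVKl.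
Qed.

(* The lifts of the detours need not start at the ends of a.  At either end,
   moving both points of the fibre together to points over S cuts the
   completed piece into three paths that lift: from the lift of k, along a,
   and into the lift of l. *)
Let joined_lifts e e' (a : path_class R e e') x y (h : path_class R x y) :
  lifts a h -> joined h.
Proof.
move=> ah z w k l f f' g g' c d Sz Sw ck dl.
have [ex e'y] := fibre_equal_ends ah.
have [fx _] := fibre_equal_ends ck; have [gy _] := fibre_equal_ends dl.
have fe : p f = p e by rewrite fx ex.
have ge : p g = p e' by rewrite gy e'y.
have [v [v' [m [m' mm']]]] := pair_paths meets fe.
have [u [u' [n [n' nn']]]] := pair_paths meets ge.
have [i [mi m'i]] := fibre_equal_image fx mm'.
have [j [nj n'j]] := fibre_equal_image gy nn'.
have Sv : S (p (sval v)) := set_mem (svalP v).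
have Su : S (p (sval u)) := set_mem (svalP u).
have W1 : W (class_cat (class_rev k) i).
  by apply: W_lifts => //; apply: fibre_equal_cat mi; exact: fibre_equal_rev ck.
have W2 : W (class_cat (class_rev i) (class_cat h j)).
  apply: W_lifts => //; apply: fibre_equal_cat; first exact: fibre_equal_rev m'i.
  exact: fibre_equal_cat ah n'j.
have W3 : W (class_cat (class_rev j) l).
  by apply: W_lifts => //; apply: fibre_equal_cat dl; exact: fibre_equal_rev nj.
have := W_cat Sz Sv Sw W1 (W_cat Sv Su Sw W2 W3).
by rewrite !class_cat_assoc !class_catVKl.
Qed.

(** Pieces that lift are joined, and joined pieces concatenate: the detours at
    the common end point cancel.  At the ends of the whole path, which lie in S,
    the detours may be taken constant. *)
Lemma generated_by_lifts x y (a : path_class R x y) : S x -> S y -> W a.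
Proof.
move=> Sx Sy; rewrite -[a]class_ofK; move: (repr a) => {a} q.
have cm := curve_continuous q.
have J : joined (class_of (arc_path cm 0 1)).
  move: (lexx (0 : R)) (@ler01 R) (lexx (1 : R)).
  apply: (@interval_induction _ (fun a b => joined (class_of (arc_path cm a b)))).
    by move=> a b c _ _ _ _ Jab Jbc; rewrite -(arc_cat cm a b c); exact: joined_cat.
  move=> t _; have [e e0 lift] := curve_local_lift t ls cm; exists e => //.
  move=> a b _ ab _ ta bt; have [f cf fm] := lift a b ab ta bt.
  apply: (@joined_lifts _ _ (class_of (arc_path cf a b))).
  exists (arc_path cf a b), (arc_path cm a b); split=> // t'; rewrite !arc_pathE.
  by apply: fm; have /andP[t0 t1] := unit_interval_itv t'; apply/andP; split; nra.
have q0 : q (clamp 0) = x by exact: path_zero.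
have q1 : q (clamp 1) = y by exact: path_one.
have [e ex] := locally_sectionable_surj ls (q (clamp 0)).
have [f fy] := locally_sectionable_surj ls (q (clamp 1)).
have Sm0 : S (q (clamp 0)) by rewrite q0.
have Sm1 : S (q (clamp 1)) by rewrite q1.
have := J _ _ _ _ _ _ _ _ _ _ Sm0 Sm1
  (fibre_equal_cst (p' := fun b : B => b) ex)
  (fibre_equal_cst (p' := fun b : B => b) fy).
rewrite class_cat_cstr.
have -> : class_rev (class_cst (q (clamp 0))) =
    class_cst (q (clamp 0)) :> path_class R _ _.
  by rewrite -[LHS]class_cat_cstl class_cat_revr.
rewrite class_cat_cstl.
have : forall t, arc_path cm 0 1 t = q t.
  by move=> t; rewrite arc_pathE subr0 mulr1 add0r svalK.
move: (arc_path cm 0 1); rewrite q0 q1 => r rq.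
by rewrite (_ : r = q) //; exact/path_eqP.
Qed.

End generation.

Section uniqueness.
Context {R : realType} {E B : topologicalType} (p : continuousType E B) (S : set B).
Local Notation A := (p @^-1` S).
Context (ls : locally_sectionable p).
Context (meets : meets_path_components R (fp_base (fp_base p p) p @^-1` S)).
Local Notation gam := (pi1_map R p (@map_over _ _ p S) : functor (pi1 R A) (pi1 R S)).

(** The arrows on which G and H agree contain the images of paths of E and are
    closed under composition. *)
Lemma pi1_map_epi (L : groupoid) (G H : functor (pi1 R S) L) :
  comp_functor G gam = comp_functor H gam -> G = H.
Proof.
move=> GH.
have obj_e (s : S) : exists (g : A), s = gam g.
  have [e es] := locally_sectionable_surj ls (sval s).
  have Se : A e by rewrite /preimage /= es; exact: (set_mem (svalP s)).
  by exists (set_point Se); apply: val_inj.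
have e (s : S) : G s = H s.
  by have [g ->] := obj_e s; exact: (congr1 (fun K : functor (pi1 R A) L => K g) GH).
pose W x y (a : path_class R x y) := forall (Sx : x \in S) (Sy : y \in S),
  let s : pi1 R S := exist _ x Sx in let t : pi1 R S := exist _ y Sy in
  cmp (fhom G (a : @hom (pi1 R S) s t)) (eq_arrow (e t)) =
  cmp (eq_arrow (e s)) (fhom H (a : @hom (pi1 R S) s t)).
apply: (@functor_ext _ _ G H e) => -[x Sx] [y Sy] a.
suff : W x y a by apply.
apply: (generated_by_lifts ls meets (W := W)); try exact: set_mem.
- move=> {}x {}y z {}a b {}Sx {}Sy Sz Wa Wb /= Sx' Sz'.
  pose s : pi1 R S := exist _ x Sx'; pose t : pi1 R S := set_point Sy.
  pose u : pi1 R S := exist _ z Sz'.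
  pose a' : hom s t := a; pose b' : hom t u := b.
  have Wa' : cmp (fhom G a') _ = cmp _ (fhom H a') := Wa Sx' (mem_set Sy).
  have Wb' : cmp (fhom G b') _ = cmp _ (fhom H b') := Wb (mem_set Sy) Sz'.
  suff : cmp (fhom G (cmp a' b')) (eq_arrow (e u)) =
      cmp (eq_arrow (e s)) (fhom H (cmp a' b')) by [].
  by rewrite !fhom_cmp cmp_assoc Wb' -cmp_assoc Wa' cmp_assoc.
- move=> f f' {}a Sf Sf' {}Sx {}Sy /=.
  have := functor_eq_natural GH (a : @hom (pi1 R A) (set_point Sf) (set_point Sf')).
  move=> /(_ (e _) (e _)) /=.
  rewrite (Prop_irrelevance (mem_set (@map_over _ _ p S f _)) Sx).
  by rewrite (Prop_irrelevance (mem_set (@map_over _ _ p S f' _)) Sy).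
Qed.

End uniqueness.

(** * The coequalizer *)

Lemma pi1_eq_arrow (R : realType) (X : topologicalType) (S : set X)
    (s s' t t' : pi1 R S) (q : {path unit_interval R from sval s to sval t})
    (r : {path unit_interval R from sval s' to sval t'}) (e : s = s') (e' : t = t') :
  (forall u, q u = r u) ->
  cmp (class_of q : hom s t) (eq_arrow e') =
  cmp (eq_arrow e) (class_of r : hom s' t').
Proof.
move: q r; case: s' / e; case: t' / e' => q r qr.
rewrite cmp_idl cmp_idr; congr class_of; exact/path_eqP.
Qed.

Lemma pi1_map_coequalizes (R : realType) (E B : topologicalType)
    (p : continuousType E B) (S : set B) :
  let c : functor (pi1 R (p @^-1` S)) (pi1 R S) := pi1_map R p (@map_over _ _ p S) in
  comp_functor c (pi1_map R (fst_proj p p) (@fst_proj_over _ _ _ p p S)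
    : functor (pi1 R (fp_base p p @^-1` S)) _) =
  comp_functor c (pi1_map R (snd_proj p p) (@snd_proj_over _ _ _ p p S)
    : functor (pi1 R (fp_base p p @^-1` S)) _).
Proof.
move=> c.
set a := (X in comp_functor c X = _); set b := (X in _ = comp_functor c X).
have e z : comp_functor c a z = comp_functor c b z.
  by apply: val_inj; exact: (fp_baseE (sval z)).
apply: (@functor_ext _ _ (comp_functor c a) (comp_functor c b) e) => z z' w.
rewrite -[w]class_ofK; move: (repr w) => {w} q.
have -> : fhom (comp_functor c a) (class_of q) = class_of (p \o (fst_proj p p \o q)).
  by rewrite /= !class_mapE.
have -> : fhom (comp_functor c b) (class_of q) = class_of (p \o (snd_proj p p \o q)).
  by rewrite /= !class_mapE.
apply: pi1_eq_arrow => u; exact: (fp_baseE (q u)).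
Qed.

Theorem theorem2p2 (R : realType) (E B : topologicalType)
    (p : continuousType E B) (S : set B) :
  locally_sectionable p ->
  meets_path_components R (fp_base (fp_base p p) p @^-1` S) ->
  is_coequalizer
    (pi1_map R (fst_proj p p) (@fst_proj_over _ _ _ p p S)
      : functor (pi1 R (fp_base p p @^-1` S)) (pi1 R (p @^-1` S)))
    (pi1_map R (snd_proj p p) (@snd_proj_over _ _ _ p p S)
      : functor (pi1 R (fp_base p p @^-1` S)) (pi1 R (p @^-1` S)))
    (pi1_map R p (@map_over _ _ p S)
      : functor (pi1 R (p @^-1` S)) (pi1 R S)).
Proof.
move=> ls meets; split; first exact: pi1_map_coequalizes.
move=> L F Fab; exists (glued_functor Fab ls meets); split.
  exact: glued_functorK.
by move=> G GF; apply: (pi1_map_epi ls meets); rewrite GF; exact: glued_functorK.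
Qed.
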